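(* Let $k$ and $s$ be non-negative real numbers with $0\le s<k$. Let $(A,B_1,\ldots,B_p)$ satisfy conditions (i)–(ii) of the context and be $k$-weakly-coupled. Assume that there exist $d>0$ and $0\le r<k$ such that $\|B_l\psi\|\le d\,\|\psi\|_{r/2}$ for every $\psi\in D(|A|^{r/2})$ and every $l\in\{1,\ldots,p\}$. Then for every $\varepsilon>0$, $K\ge 0$, $n\in\mathbf{N}$, and $(\psi_j)_{1\le j\le n}$ in $D(|A|^{k/2})^n$, there exists $N\in\mathbf{N}$ such that for every piecewise constant function $u=(u_1,\ldots,u_p)$, $$\sum_{l=1}^p\|u_l\|_{L^1}<K \implies \|\Upsilon^u_t(\psi_j)-X^u_{(N)}(t,0)\,\pi_N\psi_j\|_{s/2}<\varepsilon$$ for every $t\ge 0$ and every $j=1,\ldots,n$.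
   Context: $H$ is a separable complex Hilbert space with norm $\|\cdot\|$ and inner product $\langle\cdot,\cdot\rangle$ (linear in the second argument); $\mathbf{N}=\{1,2,\ldots\}$. $(A,B_1,\ldots,B_p)$ is a $(p+1)$-tuple of linear operators in $H$. Conditions: (i) for every $u\in\mathbf{R}^p$, $A+\sum_l u_lB_l$ is essentially skew-adjoint on the domain $D(A)$ of $A$, and $\mathrm{i}(A+\sum_l u_lB_l)$ is bounded from below; (ii) $A$ is skew-adjoint with purely discrete spectrum $(-\mathrm{i}\lambda_j)_{j\in\mathbf{N}}$, where $(\lambda_j)_{j\in\mathbf{N}}$ is positive, non-decreasing and unbounded. $(\phi_j)_{j\in\mathbf{N}}$ is a Hilbert basis of $H$ with $A\phi_j=-\mathrm{i}\lambda_j\phi_j$. $A+\sum_l u_lB_l$ also denotes its skew-adjoint closure, and $D(A+\sum_l u_lB_l)$ is the domain on which it is skew-adjoint. For $s\ge 0$, $D(|A|^s)=\{\psi\in H:\sum_j\lambda_j^{2s}|\langle\phi_j,\psi\rangle|^2<\infty\}$, $|A|^s\psi=\sum_j\lambda_j^s\langle\phi_j,\psi\rangle\phi_j$, and $\|\psi\|_s=\||A|^s\psi\|$. Powers of the modulus of other skew-adjoint operators are defined likewise by functional calculus. A bound on $\|B_l\psi\|$ for $\psi\in D(|A|^{r/2})$ presupposes that $B_l$ is defined on $D(|A|^{r/2})$. For $k>0$, $(A,B_1,\ldots,B_p)$ (satisfying (i)) is $k$-weakly-coupled if for every $u\in\mathbf{R}^p$, $D(|A+\sum_l u_lB_l|^{k/2})=D(|A|^{k/2})$,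 and there is a constant $C$ such that for every $1\le l\le p$ and $\psi\in D(|A|^k)$, $|\Re\langle|A|^k\psi,B_l\psi\rangle|\le C|\langle|A|^k\psi,\psi\rangle|$. Propagator: for a piecewise constant $u=\sum_{n=0}^N u^n\chi_{[t_n,t_{n+1})}$ with values in $\mathbf{R}^p$, $0=t_0\le t_1\le\cdots\le t_{N+1}$ (so $u=0$ from $t_{N+1}$ on), $\Upsilon^u_t$ is the unitary operator $$\Upsilon^u_t=e^{(t-t_{j-1})(A+\sum_l u_l^{j-1}B_l)}\circ e^{(t_{j-1}-t_{j-2})(A+\sum_l u_l^{j-2}B_l)}\circ\cdots\circ e^{(t_1-t_0)(A+\sum_l u_l^0B_l)}$$ for $t\in[t_{j-1},t_j)$, extended with control $0$ after $t_{N+1}$; i.e. $t\mapsto\Upsilon^u_t\psi_0$ is the solution of $\frac{d\psi}{dt}=(A+\sum_l u_l(t)B_l)\psi$, $\psi(0)=\psi_0$. Galerkin approximation: $\pi_N\psi=\sum_{j\le N}\langle\phi_j,\psi\rangle\phi_j$, $A^{(N)}=\pi_NA\pi_N$, $B_l^{(N)}=\pi_NB_l\pi_N$, and $X^u_{(N)}(t,s)$ is the propagator (from time $s$ to time $t$) in $H$ of $\dot x=(A^{(N)}+\sum_{l=1}^p u_l(t)B_l^{(N)})x$. *)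

(* Defs.v *)
From HB Require Import structures.
From mathcomp Require Export all_boot all_order all_algebra.
From mathcomp Require Export all_classical all_reals all_analysis.
From mathcomp Require Export complex.

Set Implicit Arguments.
Unset Strict Implicit.
Unset Printing Implicit Defensive.

Export Order.TTheory GRing.Theory Num.Theory.
Export numFieldNormedType.Exports.

Local Open Scope classical_set_scope.
Local Open Scope ring_scope.
Local Open Scope complex_scope.

(* Norms over R[i] take their values in R[i]; [rnorm] is the same norm seen in
   R, both for vectors and for complex numbers. *)
Definition rnorm (R : realType) (V : normedZmodType R[i]) (x : V) : R :=
  complex.Re `|x|.

Record hilbertSpace (R : realType) := HilbertSpace {
  hilbert_sort :> completeNormedModType R[i];
  hilbert_dot : {dot hilbert_sort for Num.conj};
  hilbert_normE : forall x : hilbert_sort, `|x| ^+ 2 = hilbert_dot x x;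
  hilbert_separable : exists2 S : set hilbert_sort, countable S & dense S }.

(* Library forms are linear in their first argument; the convention here is
   linearity in the second one. *)
Definition inner (R : realType) (H : hilbertSpace R) (x y : H) : R[i] :=
  hilbert_dot H y x.

Notation "'<[' x , y ']>'" := (inner x y) (format "<[ x ,  y ]>").

Section Operators.
Variables (R : realType) (H : hilbertSpace R).

(* A linear operator in H: only the values of [op_fun] on [op_dom] matter. *)
Record operator := Operator {
  op_dom : set H;
  op_fun :> H -> H;
  op_dom0 : op_dom 0;
  op_domP : forall (a : R[i]) x y,
    op_dom x -> op_dom y -> op_dom (a *: x + y);
  op_linear : forall (a : R[i]) x y,
    op_dom x -> op_dom y -> op_fun (a *: x + y) = a *: op_fun x + op_fun y }.

Definition op_graph (T : operator) : set (H * H) :=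
  [set z | op_dom T z.1 /\ z.2 = T z.1].

Definition graph_dom (G : set (H * H)) : set H := [set z.1 | z in G].

Definition graph_adjoint (G : set (H * H)) : set (H * H) :=
  [set z | forall w, G w -> <[z.1, w.2]> = <[z.2, w.1]>].

Definition skew_adjoint (G : set (H * H)) : Prop :=
  dense (graph_dom G) /\ graph_adjoint G = [set z | G (z.1, - z.2)].

Definition essentially_skew_adjoint (G : set (H * H)) : Prop :=
  skew_adjoint (closure G).

(* i G is bounded from below. *)
Definition i_bounded_below (G : set (H * H)) : Prop :=
  exists c : R, forall z, G z ->
    c * rnorm z.1 ^+ 2 <= complex.Re <[z.1, 'i *: z.2]>.

Definition resolvent_set (T : operator) : set R[i] :=
  [set z | exists M : H -> H,
    [/\ exists C : R, forall y, rnorm (M y) <= C * rnorm y,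
        forall y, op_dom T (M y) /\ T (M y) - z *: M y = y &
        forall x, op_dom T x -> M (T x - z *: x) = x]].

Definition spectrum (T : operator) : set R[i] := ~` resolvent_set T.

(* Projection-valued measure E on the Borel sets of R with G = i \int y dE(y),
   where mu x is the scalar measure S |-> <x, E S x>.  The operator G is
   determined by its domain and its quadratic form. *)
Record spectral_resolution (G : set (H * H))
    (E : set (measurableTypeR R) -> H -> H)
    (mu : H -> {measure set (measurableTypeR R) -> \bar R}) : Prop := {
  spectral_linear : forall S, measurable S -> linear (E S);
  spectral_self_adjoint : forall S, measurable S ->
    forall x y, <[x, E S y]> = <[E S x, y]>;
  spectral_setI : forall S S', measurable S -> measurable S' ->
    forall x, E (S `&` S') x = E S (E S' x);
  spectral_setT : forall x, E setT x = x;
  spectral_measure : forall S, measurable S ->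
    forall x, mu x S = (complex.Re <[x, E S x]>)%:E;
  spectral_dom : graph_dom G =
    [set x | (\int[mu x]_y (y ^+ 2)%:E < +oo)%E];
  spectral_form : forall z, G z ->
    <[z.1, z.2]> = 'i * (\int[mu z.1]_y y)%:C }.

(* D(|G|^s) for a skew-adjoint G; the spectral resolution of G exists and is
   unique by the spectral theorem. *)
Definition abs_power_dom (G : set (H * H)) (s : R) : set H :=
  [set x | exists E mu, spectral_resolution G E mu /\
     (\int[mu x]_y (`|y| `^ (2 * s))%:E < +oo)%E].

(* U t = e^{tG}: for skew-adjoint G there is exactly one such U (Stone). *)
Record unitary_group_of (G : set (H * H)) (U : R -> H -> H) : Prop := {
  group_linear : forall t, linear (U t);
  group_isometry : forall t x, `|U t x| = `|x|;
  group0 : forall x, U 0 x = x;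
  groupD : forall t t' x, U (t + t') x = U t (U t' x);
  group_continuous : forall x, continuous (fun t => U t x);
  group_generator : forall x y,
    G (x, y) <-> (h^-1)%:C *: (U h x - x) @[h --> 0^'] --> y }.

End Operators.

(* phi is indexed from 0: phi j and lambda j stand for phi_{j+1} and
   lambda_{j+1}. *)
Section Basis.
Variables (R : realType) (H : hilbertSpace R).
Variables (phi : nat -> H) (lambda : nat -> R).

Definition hilbert_basis : Prop :=
  (forall i j, <[phi i, phi j]> = (i == j)%:R) /\
  (forall psi, series (fun j => <[phi j, psi]> *: phi j) @ \oo --> psi).

Definition absA_dom (s : R) : set H :=
  [set psi | (\sum_(0 <= j <oo)
     (lambda j `^ (2 * s) * rnorm <[phi j, psi]> ^+ 2)%:E < +oo)%E].

(* Meaningful for psi in [absA_dom s], where the series converges. *)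
Definition absA (s : R) (psi : H) : H :=
  lim (series (fun j => ((lambda j `^ s)%:C * <[phi j, psi]>) *: phi j) @ \oo).

Definition absA_norm (s : R) (psi : H) : R := rnorm (absA s psi).

Definition galerkin_proj (N : nat) (psi : H) : H :=
  \sum_(j < N) <[phi j, psi]> *: phi j.

Definition galerkin_op (N : nat) (T : operator H) (psi : H) : H :=
  galerkin_proj N (T (galerkin_proj N psi)).

End Basis.

Section ControlSystem.
Variables (R : realType) (H : hilbertSpace R) (p : nat).
Variables (A : operator H) (B : 'I_p -> operator H).

(* A + \sum_l v_l B_l with domain D(A). *)
Definition perturbed (v : 'I_p -> R) : set (H * H) :=
  [set z | op_dom A z.1 /\ z.2 = A z.1 + \sum_l (v l)%:C *: B l z.1].

Definition condition_i : Prop :=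
  (forall l, op_dom A `<=` op_dom (B l)) /\
  (forall v, essentially_skew_adjoint (perturbed v) /\
             i_bounded_below (perturbed v)).

Record condition_ii (phi : nat -> H) (lambda : nat -> R) : Prop := {
  ii_skew_adjoint : skew_adjoint (op_graph A);
  ii_spectrum : spectrum A = range (fun j => - 'i * (lambda j)%:C);
  ii_positive : forall j, 0 < lambda j;
  ii_nondecreasing : forall i j, (i <= j)%N -> lambda i <= lambda j;
  ii_unbounded : forall M : R, exists j, M < lambda j;
  ii_basis : hilbert_basis phi;
  ii_eigen : forall j,
    op_dom A (phi j) /\ A (phi j) = (- 'i * (lambda j)%:C) *: phi j }.

Definition weakly_coupled (phi : nat -> H) (lambda : nat -> R) (k : R) : Prop :=
  (forall v, abs_power_dom (closure (perturbed v)) (k / 2) =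
             absA_dom phi lambda (k / 2)) /\
  exists C : R, forall l psi, absA_dom phi lambda k psi ->
    op_dom (B l) psi /\
    `|complex.Re <[absA phi lambda k psi, B l psi]>| <=
      C * rnorm <[absA phi lambda k psi, psi]>.

(* The piecewise constant function \sum_(n <= N) val n \chi_[tm n, tm n.+1),
   with N = last_piece. *)
Record pw_control := PwControl {
  last_piece : nat;
  tm : nat -> R;
  val : nat -> 'I_p -> R;
  tm0 : tm 0 = 0;
  tm_le : forall n, (n <= last_piece)%N -> tm n <= tm n.+1 }.

Definition control_fun (u : pw_control) (l : 'I_p) (t : R) : R :=
  \sum_(n < (last_piece u).+1) val u n l * \1_(`[tm u n, tm u n.+1[) t.

Definition control_L1 (u : pw_control) (l : 'I_p) : \bar R :=
  (\int[lebesgue_measure]_(t in `[0%R, +oo[) `|control_fun u l t|%:E)%E.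

(* Propagator from time 0 to time t, where e v s stands for
   exp (s (A + \sum_l v_l B_l)).  Piece n contributes the length of
   [tm n, tm n.+1) before t, so pieces starting after t have duration 0; the
   control is 0 after the last piece. *)
Fixpoint propagator_pieces (e : ('I_p -> R) -> R -> H -> H) (u : pw_control)
    (t : R) (n : nat) (psi : H) : H :=
  if n is m.+1 then
    e (val u m) (Num.min t (tm u m.+1) - Num.min t (tm u m))
      (propagator_pieces e u t m psi)
  else psi.

Definition propagator (e : ('I_p -> R) -> R -> H -> H) (u : pw_control)
    (t : R) (psi : H) : H :=
  let N := (last_piece u).+1 in
  e (fun=> 0) (t - Num.min t (tm u N)) (propagator_pieces e u t N psi).

(* X t s is the propagator, from time s to time t, of
   x' = (A^(N) + \sum_l u_l(t) B_l^(N)) x on [0, +oo[: solutions are continuous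
   and satisfy the equation away from the discontinuities of u. *)
Definition galerkin_propagator (phi : nat -> H) (N : nat) (u : pw_control)
    (X : R -> R -> H -> H) : Prop :=
  forall s x, 0 <= s ->
  [/\ X s s x = x,
      {within `[0, +oo[, continuous (fun t => X t s x)} &
      forall t, 0 < t ->
        (forall n, (n <= (last_piece u).+1)%N -> t != tm u n) ->
        (h^-1)%:C *: (X (t + h) s x - X t s x) @[h --> 0^'] -->
          galerkin_op phi N A (X t s x) +
          \sum_l (control_fun u l t)%:C *: galerkin_op phi N (B l) (X t s x)].

End ControlSystem.

(* Main.v *)
Require Import Defs.
From mathcomp Require Import ring lra measurable_realfun.

(** Write x_N for the Galerkin solution X_(N)(., 0) pi_N psi, and E_k(z) for the
    k-energy of z, the sum of the lambda_j^k |<phi_j, z>|^2.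

    The Galerkin solutions have energies bounded independently of N.  A vector
    of a Galerkin space lies in every D(|A|^s), and pi_N commutes with |A|^k, so
    along x_N the derivative of E_k is
    2 Re <|A|^k x_N, (A + sum_l u_l B_l) x_N>.  The term in A vanishes since A
    is diagonal with imaginary eigenvalues, and weak coupling bounds the rest
    by 2 C |u| E_k.  By Gronwall, E_k(x_N(t)) <= exp(2 C K) E_k(psi)
    ([galerkin_energy], [galerkin_path_energy]).  This estimate is made on the
    finite-dimensional solutions because |A|^k x is meaningful for them, while
    the exact solution need not stay in D(|A|^k).

    For the exact dynamics, x_N is a solution up to the defect
    sum_l u_l (1 - pi_N) B_l x_N.  The exact propagator is isometric, so
    Duhamel's formula bounds the distance in H of x_N to the exact solution by
    |(1 - pi_N) psi| + K eta_N, where eta_N is the supremum of the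
    |(1 - pi_N) B_l z| over Galerkin vectors z with E_k(z) bounded as above
    ([duhamel_le], [galerkin_error], [propagator_error]).  Since r < k and
    lambda_j tends to infinity, such z form a relatively compact set in
    D(|A|^(r/2)), which B_l maps continuously into H; as the projections
    converge uniformly on compact sets, eta_N tends to 0 ([near_compl_opB]).
    Hence x_N converges to the exact solution in H, uniformly in the control
    and in time ([near_propagator_norm]).

    The convergence in H improves by interpolation.  The exact solution is a
    limit of vectors of bounded energy, so it has bounded energy, and so has
    its difference delta with x_N ([propagator_energy]).  As s < k, the
    coordinates of delta beyond some index M contribute little to its s-norm,
    uniformly; the first M contribute at most a constant times |delta|
    ([energy_split], [near_propagator_energy]). *)

Set Implicit Arguments.
Unset Strict Implicit.
Unset Printing Implicit Defensive.

Local Open Scope classical_set_scope.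
Local Open Scope ring_scope.
Local Open Scope complex_scope.

(** * Norms and inner products seen in R *)

Section ComplexNorm.
Variables (R : realType).
Implicit Types (V : normedZmodType R[i]) (z : R[i]).

Lemma normr_rnorm V (x : V) : `|x| = (rnorm x)%:C.
Proof. by rewrite /rnorm RRe_real// realE normr_ge0. Qed.

Lemma rnorm_ge0 V (x : V) : 0 <= rnorm x.
Proof. by rewrite -ler0c -normr_rnorm normr_ge0. Qed.

Lemma rnorm0 V : rnorm (0 : V) = 0.
Proof. by rewrite /rnorm normr0. Qed.

Lemma rnorm_eq0 V (x : V) : rnorm x = 0 -> x = 0.
Proof. by move=> x0; apply/eqP; rewrite -normr_eq0 normr_rnorm x0. Qed.

Lemma rnormN V (x : V) : rnorm (- x) = rnorm x.
Proof. by rewrite /rnorm normrN. Qed.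

Lemma rnormD V (x y : V) : rnorm (x + y) <= rnorm x + rnorm y.
Proof. by rewrite -lecR rmorphD/= -!normr_rnorm ler_normD. Qed.

Lemma rnorm_distC V (x y : V) : rnorm (x - y) = rnorm (y - x).
Proof. by rewrite -rnormN opprB. Qed.

Lemma rnorm_sum V (I : Type) (r : seq I) (P : pred I) (F : I -> V) :
  rnorm (\sum_(i <- r | P i) F i) <= \sum_(i <- r | P i) rnorm (F i).
Proof.
elim/big_ind2 : _ => [|x a y b xa yb|//]; first by rewrite rnorm0.
by rewrite (le_trans (rnormD _ _))// lerD.
Qed.

Lemma rnormZ (V : normedModType R[i]) z (x : V) :
  rnorm (z *: x) = rnorm z * rnorm x.
Proof. by apply: complexI; rewrite rmorphM/= -!normr_rnorm normrZ. Qed.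

Lemma rnormM (z1 z2 : R[i]) : rnorm (z1 * z2) = rnorm z1 * rnorm z2.
Proof. by apply: complexI; rewrite rmorphM/= -!normr_rnorm normrM. Qed.

Lemma rnorm_real (a : R) : rnorm (a%:C : R[i]) = `|a|.
Proof. by rewrite /rnorm normc_def/= expr0n addr0 sqrtr_sqr. Qed.

Lemma sqr_rnorm z : rnorm z ^+ 2 = complex.Re z ^+ 2 + complex.Im z ^+ 2.
Proof. by apply: complexI; rewrite add_Re2_Im2 normr_rnorm rmorphXn. Qed.

Lemma conj_realC (a : R) : Num.conj (a%:C : R[i]) = a%:C.
Proof. exact: conjc_real. Qed.

End ComplexNorm.

Section InnerProduct.
Variables (R : realType) (H : hilbertSpace R).
Implicit Types (x y w : H) (a : R[i]).

Lemma innerDr w x y : <[w, x + y]> = <[w, x]> + <[w, y]>.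
Proof. exact: (linearDl (hilbert_dot H)). Qed.

Lemma innerNr w x : <[w, - x]> = - <[w, x]>.
Proof. exact: (linearNl (hilbert_dot H)). Qed.

Lemma innerBr w x y : <[w, x - y]> = <[w, x]> - <[w, y]>.
Proof. by rewrite innerDr innerNr. Qed.

Lemma innerZr w a x : <[w, a *: x]> = a * <[w, x]>.
Proof. exact: (linearZl_LR (hilbert_dot H)). Qed.

Lemma inner0r w : <[w, 0]> = 0.
Proof. exact: (linear0l (hilbert_dot H)). Qed.

Lemma inner_sumr w (I : Type) (r : seq I) (P : pred I) (F : I -> H) :
  <[w, \sum_(i <- r | P i) F i]> = \sum_(i <- r | P i) <[w, F i]>.
Proof.
exact: (big_morph (inner w) (innerDr w) (inner0r w)).
Qed.

Lemma innerC x y : <[x, y]> = Num.conj <[y, x]>.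
Proof.
by rewrite /inner (hermC (hilbert_dot H)) expr0 mul1r.
Qed.

Lemma innerDl w x y : <[x + y, w]> = <[x, w]> + <[y, w]>.
Proof. by rewrite innerC innerDr rmorphD/= -!innerC. Qed.

Lemma innerZl w a x : <[a *: x, w]> = Num.conj a * <[x, w]>.
Proof. by rewrite innerC innerZr rmorphM/= -!innerC. Qed.

Lemma inner0l w : <[0, w]> = 0.
Proof. by rewrite innerC inner0r rmorph0. Qed.

Lemma inner_suml w (I : Type) (r : seq I) (P : pred I) (F : I -> H) :
  <[\sum_(i <- r | P i) F i, w]> = \sum_(i <- r | P i) <[F i, w]>.
Proof.
by apply: (big_morph (fun z => <[z, w]>)) => [x y|]; rewrite ?innerDl ?inner0l.
Qed.

(** Testing a curve of H against a fixed vector through this form gives a real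
    function, to which the mean value theorem applies. *)
Definition rdot x y : R := complex.Re <[x, y]>.

Lemma rdotDr w x y : rdot w (x + y) = rdot w x + rdot w y.
Proof. by rewrite /rdot innerDr raddfD. Qed.

Lemma rdotNr w x : rdot w (- x) = - rdot w x.
Proof. by rewrite /rdot innerNr raddfN. Qed.

Lemma rdotBr w x y : rdot w (x - y) = rdot w x - rdot w y.
Proof. by rewrite rdotDr rdotNr. Qed.

Lemma rdot0r w : rdot w 0 = 0.
Proof. by rewrite /rdot inner0r. Qed.

Lemma rdotZr w (a : R) x : rdot w (a%:C *: x) = a * rdot w x.
Proof.
by rewrite /rdot innerZr; case: <[w, x]> => u v /=; rewrite mul0r subr0.
Qed.

Lemma rdot_sumr w (I : Type) (r : seq I) (P : pred I) (F : I -> H) :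
  rdot w (\sum_(i <- r | P i) F i) = \sum_(i <- r | P i) rdot w (F i).
Proof. exact: (big_morph (rdot w) (rdotDr w) (rdot0r w)). Qed.

Lemma rdotC x y : rdot x y = rdot y x.
Proof. by rewrite /rdot innerC; case: <[y, x]>. Qed.

Lemma rdotxx x : rdot x x = rnorm x ^+ 2.
Proof.
by rewrite /rdot /inner -hilbert_normE normr_rnorm -rmorphXn.
Qed.

(** Cauchy-Schwarz, from the square of q x - p y where p = |x| and q = |y|. *)
Lemma rdot_le x y : rdot x y <= rnorm x * rnorm y.
Proof.
have [/rnorm_eq0->|y0] := eqVneq (rnorm y) 0.
  by rewrite rdot0r rnorm0 mulr0.
have ygt0 : 0 < rnorm y by rewrite lt0r y0 rnorm_ge0.
have [/rnorm_eq0->|x0] := eqVneq (rnorm x) 0.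
  by rewrite rdotC rdot0r rnorm0 mul0r.
have xgt0 : 0 < rnorm x by rewrite lt0r x0 rnorm_ge0.
set p := rnorm x; set q := rnorm y.
have : 0 <= rdot (q%:C *: x - p%:C *: y) (q%:C *: x - p%:C *: y).
  by rewrite rdotxx sqr_ge0.
rewrite rdotBr !rdotZr rdotC rdotBr (rdotC (_ - _) y) rdotBr !rdotZr.
rewrite !rdotxx -/p -/q (rdotC y x) => h.
have {h} : 0 <= (p * q) * (p * q - rdot x y) by nra.
by rewrite pmulr_rge0 ?mulr_gt0// subr_ge0.
Qed.

Lemma norm_rdot_le x y : `|rdot x y| <= rnorm x * rnorm y.
Proof.
rewrite ler_norml rdot_le andbT lerNl -rdotNr.
by rewrite (le_trans (rdot_le _ _))// rnormN.
Qed.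

(** The phase of <x, y> is absorbed in x, which reduces to the real form. *)
Lemma rnorm_inner_le x y : rnorm <[x, y]> <= rnorm x * rnorm y.
Proof.
have [->|c0] := eqVneq (rnorm <[x, y]>) 0; first by rewrite mulr_ge0 ?rnorm_ge0.
have cgt0 : 0 < rnorm <[x, y]> by rewrite lt0r c0 rnorm_ge0.
have := rdot_le (<[x, y]> *: x) y.
rewrite rnormZ -mulrA -[X in X <= _](_ : rnorm <[x, y]> ^+ 2 = _).
  by rewrite expr2 ler_pM2l.
rewrite /rdot innerZl; case: <[x, y]> => u v.
by rewrite sqr_rnorm/=; ring.
Qed.

Lemma rnorm_isometry (f : H -> H) : (forall x, `|f x| = `|x|) ->
  forall x, rnorm (f x) = rnorm x.
Proof. by move=> fN x; rewrite /rnorm fN. Qed.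

End InnerProduct.

Section RealConvergence.
Variables (R : realType) (V : normedModType R[i]) (T : Type).
Context {F : set_system T} {FF : Filter F}.
Implicit Types (f : T -> V) (y : V).

(** The radii of the balls of a complex normed space are complex numbers; the
    positive ones are real. *)
Lemma cvg_rnormP f y :
  f @ F --> y <-> forall e : R, 0 < e -> \forall t \near F, rnorm (f t - y) < e.
Proof.
split=> [fy e e0|fy].
  have /cvgrPdist_lt/(_ e%:C) := fy.
  rewrite ltcR => /(_ e0); apply: filterS => t.
  by rewrite normr_rnorm ltcR rnorm_distC.
apply/cvgrPdist_lt => e e0.
have eE : e = (complex.Re e)%:C by rewrite RRe_real// realE ltW.
move: e0; rewrite eE ltcR => /fy; apply: filterS => t.
by rewrite normr_rnorm ltcR rnorm_distC.
Qed.

Lemma cvg_rnorm_le (g : T -> R) f y :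
  (forall t, rnorm (f t - y) <= g t) -> g @ F --> 0 -> f @ F --> y.
Proof.
move=> fg /cvgrPdistC_lt g0; apply/cvg_rnormP => e /g0; apply: filterS => t.
by rewrite subr0; apply: le_lt_trans; rewrite (le_trans (fg t))// ler_norm.
Qed.

Lemma cvg_rnormB f y : f @ F --> y -> rnorm (f t - y) @[t --> F] --> (0 : R).
Proof.
move=> /cvg_rnormP fy; apply/cvgrPdistC_lt => e /fy; apply: filterS => t.
by rewrite subr0 ger0_norm ?rnorm_ge0.
Qed.

End RealConvergence.

Lemma cvg_rdot (R : realType) (H : hilbertSpace R) (T : Type)
    {F : set_system T} {FF : Filter F} (f : T -> H) (y w : H) :
  f @ F --> y -> rdot w (f t) @[t --> F] --> rdot w y.
Proof.
move=> /cvg_rnormB fy; apply/cvgrPdistC_lt => e e0.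
have w0 : 0 < rnorm w + 1 by rewrite ltr_wpDl ?rnorm_ge0.
have /cvgrPdistC_lt/(_ (e / (rnorm w + 1)))  := fy.
rewrite divr_gt0// => /(_ isT); apply: filterS => t.
rewrite subr0 ger0_norm ?rnorm_ge0// ltr_pdivlMr// -rdotBr; apply: le_lt_trans.
rewrite (le_trans (norm_rdot_le _ _))// mulrC ler_wpM2l ?rnorm_ge0//.
by rewrite lerDl.
Qed.

(** * Galerkin projections and energies *)

Section Orthonormal.
Variables (R : realType) (H : hilbertSpace R) (phi : nat -> H).
Hypothesis phi_on : forall i j, <[phi i, phi j]> = (i == j)%:R.
Implicit Types (x y : H) (a : nat -> R[i]) (N : nat).

Local Notation proj := (galerkin_proj phi).

Lemma inner_lincomb i N a :
  <[phi i, \sum_(j < N) a j *: phi j]> = if (i < N)%N then a i else 0.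
Proof.
rewrite inner_sumr; case: ifPn => [iN|]; last first.
  rewrite -leqNgt => Ni; apply: big1 => j _.
  by rewrite innerZr phi_on gtn_eqF ?mulr0// (leq_trans _ Ni).
rewrite (bigD1 (Ordinal iN))//= innerZr phi_on eqxx mulr1 big1 ?addr0// => j.
by rewrite -val_eqE/= => ji; rewrite innerZr phi_on eq_sym (negbTE ji) mulr0.
Qed.

(** Pythagoras. *)
Lemma sqr_rnorm_lincomb a m n :
  rnorm (\sum_(m <= j < n) a j *: phi j) ^+ 2 =
  \sum_(m <= j < n) rnorm (a j) ^+ 2.
Proof.
have : uniq (index_iota m n) by exact: iota_uniq.
elim: index_iota => [|i r ih] /=; first by rewrite !big_nil rnorm0 expr0n.
move=> /andP[ir /ih {}ih]; rewrite !big_cons -ih -!rdotxx.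
have ort : rdot (\sum_(j <- r) a j *: phi j) (a i *: phi i) = 0.
  rewrite rdotC rdot_sumr big_seq big1// => j jr.
  rewrite /rdot innerZl innerZr phi_on (_ : _ == _ = false) ?mulr0//.
  by apply: contraNF ir => /eqP ->.
rewrite rdotDr rdotC rdotDr (rdotC (_ + _) (\sum_(j <- r) _)) rdotDr ort.
rewrite (rdotC (a i *: _)) ort addr0 add0r; congr (_ + _).
rewrite /rdot innerZl innerZr phi_on eqxx mulr1 sqr_rnorm.
by case: (a i) => u v/=; ring.
Qed.

Lemma rnorm_phi i : rnorm (phi i) = 1.
Proof.
apply/eqP; rewrite -(@eqrXn2 _ 2)// ?rnorm_ge0//; apply/eqP.
by rewrite -rdotxx /rdot phi_on eqxx expr1n.
Qed.

Lemma coord_le i x : rnorm <[phi i, x]> <= rnorm x.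
Proof. by rewrite (le_trans (rnorm_inner_le _ _))// rnorm_phi mul1r. Qed.

Lemma coord_proj i N x :
  <[phi i, proj N x]> = if (i < N)%N then <[phi i, x]> else 0.
Proof. exact: (inner_lincomb i N (fun j => <[phi j, x]>)). Qed.

Lemma projD N x y : proj N (x + y) = proj N x + proj N y.
Proof.
rewrite /galerkin_proj -big_split/=; apply: eq_bigr => j _.
by rewrite innerDr scalerDl.
Qed.

Lemma projZ N (b : R[i]) x : proj N (b *: x) = b *: proj N x.
Proof.
rewrite /galerkin_proj scaler_sumr; apply: eq_bigr => j _.
by rewrite innerZr scalerA.
Qed.

Lemma projN N x : proj N (- x) = - proj N x.
Proof. by rewrite -scaleN1r projZ scaleN1r. Qed.

Lemma proj0 N : proj N 0 = 0.
Proof. by have := projZ N 0 0; rewrite !scale0r. Qed.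

Lemma proj_sum N (I : Type) (r : seq I) (P : pred I) (F : I -> H) :
  proj N (\sum_(i <- r | P i) F i) = \sum_(i <- r | P i) proj N (F i).
Proof. by apply: (big_morph (proj N)) => [x y|]; rewrite ?projD ?proj0. Qed.

Lemma proj_lincomb N M a : (M <= N)%N ->
  proj N (\sum_(j < M) a j *: phi j) = \sum_(j < M) a j *: phi j.
Proof.
move=> MN; rewrite /galerkin_proj.
under eq_bigr do rewrite inner_lincomb.
rewrite (big_ord_widen_cond N xpredT (fun j => a j *: phi j))// [RHS]big_mkcond/=.
by apply: eq_bigr => j _; case: ifP => //; rewrite scale0r.
Qed.

Lemma proj_idem N x : proj N (proj N x) = proj N x.
Proof. by rewrite {2}/galerkin_proj (proj_lincomb (fun j => <[phi j, x]>)). Qed.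

Lemma proj_phi j : proj j.+1 (phi j) = phi j.
Proof.
rewrite /galerkin_proj big_ord_recr/= phi_on eqxx scale1r big1 ?add0r// => i _.
by rewrite phi_on ltn_eqF// scale0r.
Qed.

Lemma proj_widen N M x : (N <= M)%N -> proj N x = x -> proj M x = x.
Proof.
move=> NM <-; rewrite [in LHS]/galerkin_proj.
exact: (proj_lincomb (fun j => <[phi j, x]>)).
Qed.

Lemma inner_proj N x y : <[x, proj N y]> = <[proj N x, y]>.
Proof.
rewrite /galerkin_proj inner_sumr inner_suml; apply: eq_bigr => j _.
by rewrite innerZr innerZl mulrC -innerC.
Qed.

Lemma rdot_proj N x y : rdot x (proj N y) = rdot (proj N x) y.
Proof. by rewrite /rdot inner_proj. Qed.

(** The vector y = x - pi_N x is orthogonal to pi_N x, so |y|^2 = <y, x>. *)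
Lemma rnorm_compl_le N x : rnorm (x - proj N x) <= rnorm x.
Proof.
have [->|c0] := eqVneq (rnorm (x - proj N x)) 0; first exact: rnorm_ge0.
have cgt0 : 0 < rnorm (x - proj N x) by rewrite lt0r c0 rnorm_ge0.
rewrite -(ler_pM2l cgt0) -expr2 -rdotxx rdotBr rdot_proj projD projN proj_idem.
by rewrite subrr (rdotC 0) rdot0r subr0 rdot_le.
Qed.

End Orthonormal.

Lemma powR_sqr (R : realType) (a s : R) :
  0 <= a -> (a `^ (s / 2)) ^+ 2 = a `^ s.
Proof.
by move=> a0; rewrite -powR_mulrn ?powR_ge0// -powRrM divfK.
Qed.

Section Energy.
Variables (R : realType) (H : hilbertSpace R).
Variables (phi : nat -> H) (lambda : nat -> R).
Hypothesis phi_on : forall i j, <[phi i, phi j]> = (i == j)%:R.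
Hypothesis lambda_gt0 : forall j, 0 < lambda j.
Implicit Types (x y : H) (N : nat) (s k : R).

Local Notation proj := (galerkin_proj phi).

(** The N-th partial sum of the square of the norm of order s / 2: membership in
    D(|A|^(s/2)) and bounds on that norm are bounds on it uniform in N
    ([absA_domP], [absA_norm_le]). *)
Definition energy s N x : R :=
  \sum_(j < N) lambda j `^ s * rnorm <[phi j, x]> ^+ 2.

Lemma energy_term_ge0 s j x : 0 <= lambda j `^ s * rnorm <[phi j, x]> ^+ 2.
Proof. by rewrite mulr_ge0 ?powR_ge0 ?sqr_ge0. Qed.

Lemma energy_ge0 s N x : 0 <= energy s N x.
Proof. by apply: sumr_ge0 => j _; exact: energy_term_ge0. Qed.

Lemma energy_le s N M x : (N <= M)%N -> energy s N x <= energy s M x.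
Proof.
move=> NM; rewrite /energy -!(big_mkord xpredT
  (fun j => lambda j `^ s * rnorm <[phi j, x]> ^+ 2)).
rewrite [leRHS](big_cat_nat _ (n:=N))//= lerDl; apply: sumr_ge0 => j _.
exact: energy_term_ge0.
Qed.

Lemma energyD s N x y :
  energy s N (x + y) <= 2 * energy s N x + 2 * energy s N y.
Proof.
rewrite /energy !mulr_sumr -big_split; apply: ler_sum => j _ /=.
have := rnormD <[phi j, x]> <[phi j, y]>; rewrite -innerDr.
have := rnorm_ge0 <[phi j, x + y]>; have := rnorm_ge0 <[phi j, x]>.
have := rnorm_ge0 <[phi j, y]>.
set a := rnorm _; set b := rnorm _; set c := rnorm _ => a0 b0 c0 cab.
rewrite ![2 * (_ * _)]mulrCA -mulrDr ler_wpM2l ?powR_ge0//.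
have := sqr_ge0 (a - b); nra.
Qed.

Lemma energyN s N x : energy s N (- x) = energy s N x.
Proof. by apply: eq_bigr => j _; rewrite innerNr rnormN. Qed.

Lemma energy_le_norm s N x :
  energy s N x <= (\sum_(j < N) lambda j `^ s) * rnorm x ^+ 2.
Proof.
rewrite /energy mulr_suml; apply: ler_sum => j _.
rewrite ler_wpM2l ?powR_ge0// lerXn2r ?nnegrE ?rnorm_ge0//.
exact: coord_le.
Qed.

(** The coordinates of index M or more carry the weight lambda^s, which is
    dominated there by e * lambda^k. *)
Lemma energy_split s k e M N x :
  (forall j, (M <= j)%N -> lambda j `^ s <= e * lambda j `^ k) -> 0 <= e ->
  energy s N x <= energy s M x + e * energy k N x.
Proof.
move=> He e0; have [NM|MN] := leqP N M.
  by rewrite (le_trans (energy_le _ _ NM))// lerDl mulr_ge0 ?energy_ge0.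
rewrite {1}/energy -(big_mkord xpredT
  (fun j => lambda j `^ s * rnorm <[phi j, x]> ^+ 2)).
rewrite (big_cat_nat _ (n:=M)) ?(ltnW MN)//= big_mkord lerD2l.
rewrite /energy -(big_mkord xpredT
  (fun j => lambda j `^ k * rnorm <[phi j, x]> ^+ 2)).
rewrite [in leRHS](big_cat_nat _ (n:=M)) ?(ltnW MN)//= mulrDr.
rewrite -[leLHS]add0r lerD//.
  by rewrite mulr_ge0// sumr_ge0// => j _; exact: energy_term_ge0.
rewrite mulr_sumr big_nat [leRHS]big_nat; apply: ler_sum => j /andP[Mj _].
by rewrite mulrA ler_wpM2r ?sqr_ge0// He.
Qed.

Lemma energy_proj s N M x : energy s M (proj N x) <= energy s M x.
Proof.
apply: ler_sum => j _; rewrite coord_proj//; case: ifP => // _.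
by rewrite rnorm0 expr0n mulr0 energy_term_ge0.
Qed.

(** The coordinates of such a vector of index N or more vanish. *)
Lemma energy_span s N M x : proj N x = x -> energy s M x <= energy s N x.
Proof.
move=> xN; have [MN|NM] := leqP M N; first exact: energy_le.
rewrite /energy -!(big_mkord xpredT
  (fun j => lambda j `^ s * rnorm <[phi j, x]> ^+ 2)).
rewrite [leLHS](big_cat_nat _ (n:=N)) ?(ltnW NM)//= [X in _ + X]big_nat.
rewrite [X in _ + X]big1 ?addr0// => j /andP[Nj _].
by rewrite -xN coord_proj// ltnNge Nj/= rnorm0 expr0n mulr0.
Qed.

Lemma absA_domP s x :
  absA_dom phi lambda (s / 2) x <-> exists M, forall N, energy s N x <= M.
Proof.
rewrite /absA_dom/= mulrCA divff// mulr1.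
set u := fun j => (lambda j `^ s * rnorm <[phi j, x]> ^+ 2)%:E.
have u0 n : (0 <= n)%N -> xpredT n -> (0 <= u n)%E.
  by move=> _ _; rewrite lee_fin energy_term_ge0.
have uE N : (\sum_(0 <= j < N) u j)%E = (energy s N x)%:E.
  by rewrite big_mkord sumEFin.
split=> [fin|[M Mub]].
  have := @nneseries_lim_ge R u xpredT 0%N; move: fin.
  case: (\big[_/_]_(_ <= _ <oo) _)%E => [M _ h|//|_ h].
  - by exists M => N; rewrite -lee_fin -uE; exact: h.
  - by move: (h 0%N u0); rewrite uE.
rewrite (@le_lt_trans _ _ M%:E) ?ltry//.
apply: lime_le; first exact: is_cvg_nneseries.
by apply: nearW => N; rewrite uE lee_fin.
Qed.

(** The series defining |A|^(s/2) x converges by completeness, and Pythagoras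
    passes to the limit. *)
Lemma absA_norm_le s x M :
  (forall N, energy s N x <= M) -> absA_norm phi lambda (s / 2) x ^+ 2 <= M.
Proof.
move=> Mub; rewrite /absA_norm /absA.
set u := fun j => _ *: phi j.
have uN m n : rnorm (\sum_(m <= j < n) u j) ^+ 2 =
    \sum_(m <= j < n) lambda j `^ s * rnorm <[phi j, x]> ^+ 2.
  rewrite /u sqr_rnorm_lincomb//; apply: eq_bigr => j _.
  by rewrite rnormM exprMn rnorm_real ger0_norm ?powR_ge0// powR_sqr// ltW.
pose v := fun j => lambda j `^ s * rnorm <[phi j, x]> ^+ 2.
have vE N : series v N = energy s N x by rewrite /series/= big_mkord.
have /cauchy_cvgP/cauchy_seriesP vc : cvgn (series v).
  apply: nondecreasing_is_cvgn.
    by move=> m n mn; rewrite !vE energy_le.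
  by exists M => _ [N _ <-]; rewrite vE.
have /cauchy_cvgP uc : cauchy (series u @ \oo).
  apply/cauchy_seriesP => e e0.
  have eE : e = (complex.Re e)%:C by rewrite RRe_real// realE ltW.
  move: e0; rewrite eE ltcR => e0.
  have := vc (complex.Re e ^+ 2); rewrite exprn_gt0// => /(_ isT).
  apply: filterS => -[m n]/=; rewrite -uN => h.
  rewrite normr_rnorm ltcR -(@ltr_pXn2r _ 2)// ?nnegrE ?rnorm_ge0 ?ltW//.
  by rewrite (le_lt_trans (ler_norm _) h).
set l := lim _.
have ul : series u @ \oo --> l by [].
have nn : rnorm l <= Num.sqrt M.
  apply/ler_addgt0Pr => e e0.
  have /cvg_rnormP/(_ _ e0)/filter_ex[n hn] := ul.
  rewrite -(subrK (series u n) l) addrC (le_trans (rnormD _ _))// lerD//.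
    rewrite -(ger0_norm (rnorm_ge0 _)) -sqrtr_sqr ler_wsqrtr// uN.
    by rewrite big_mkord; exact: Mub.
  by rewrite rnorm_distC ltW.
rewrite -[leRHS]sqr_sqrtr ?(le_trans _ (Mub 0%N)) ?energy_ge0//.
by rewrite lerXn2r ?nnegrE ?rnorm_ge0 ?sqrtr_ge0.
Qed.

Lemma absA_span s N x : proj N x = x ->
  absA phi lambda s x =
  \sum_(j < N) ((lambda j `^ s)%:C * <[phi j, x]>) *: phi j.
Proof.
move=> xN; rewrite /absA; apply: (@lim_near_cst _ (@norm_hausdorff _ _)).
exists N => // n /= Nn; rewrite /series/= (big_cat_nat _ (n:=N))//= big_mkord.
rewrite [X in _ + X]big_nat [X in _ + X]big1 ?addr0// => j /andP[Nj _].
by rewrite -xN coord_proj// ltnNge Nj/= mulr0 scale0r.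
Qed.

Lemma absA_dom_span s N x : proj N x = x -> absA_dom phi lambda s x.
Proof.
move=> xN; have := absA_domP (s * 2) x; rewrite mulfK// => -[_]; apply.
by exists (energy (s * 2) N x) => M; exact: energy_span.
Qed.

End Energy.

(** * Differential inequalities *)

(** The derivative of a curve of H with respect to a real parameter; H is a
    normed space over R[i] only, so the difference quotient is written with a
    complex scalar. *)
Definition hderiv (R : realType) (H : hilbertSpace R)
    (x : R -> H) (t : R) (y : H) :=
  (h^-1)%:C *: (x (t + h) - x t) @[h --> 0^'] --> y.

Section WeakDerivative.
Variables (R : realType) (H : hilbertSpace R).
Implicit Types (x : R -> H) (w y : H) (t : R).

Lemma hderiv_rdot x t y w : hderiv x t y ->
  is_derive t 1 (fun s => rdot w (x s)) (rdot w y).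
Proof.
move=> /(cvg_rdot (w := w)) xy.
have fy : h^-1 *: (((fun s => rdot w (x s)) \o shift t) (h *: 1) - rdot w (x t))
    @[h --> 0^'] --> rdot w y.
  apply: cvg_trans xy; apply: near_eq_cvg; near=> h.
  by rewrite rdotZr rdotBr /= [h *: 1]mulr1 [t + h]addrC.
by apply: DeriveDef; [apply: (cvgP (rdot w y))|apply: cvg_lim].
Unshelve. all: by end_near. Qed.

Lemma within_cvg_rdot x w a b : {within `[a, b], continuous x} ->
  {within `[a, b], continuous (fun t => rdot w (x t))}.
Proof. by move=> xc t; apply: cvg_rdot; exact: xc. Qed.

End WeakDerivative.

Section UnitaryGroup.
Variables (R : realType) (H : hilbertSpace R).
Variables (G : set (H * H)) (U : R -> H -> H).
Hypothesis UG : unitary_group_of G U.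

Lemma groupB t x y : U t (x - y) = U t x - U t y.
Proof.
have := group_linear UG t (-1) y x.
by rewrite !scaleN1r [- y + x]addrC => ->; rewrite addrC.
Qed.

Lemma groupZ t (a : R[i]) x : U t (a *: x) = a *: U t x.
Proof.
have U0 : U t 0 = 0 by have := groupB t 0 0; rewrite !subrr.
by have := group_linear UG t a x 0; rewrite !addr0 U0 addr0.
Qed.

Lemma rnorm_group t x : rnorm (U t x) = rnorm x.
Proof. exact: rnorm_isometry (group_isometry UG t) x. Qed.

Lemma cvg_group (T : Type) {F : set_system T} {FF : Filter F}
    (tau : T -> R) (x : T -> H) tau0 x0 :
  tau @ F --> tau0 -> x @ F --> x0 -> U (tau i) (x i) @[i --> F] --> U tau0 x0.
Proof.
move=> tauF xF.
have cF : U (tau i) x0 @[i --> F] --> U tau0 x0.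
  have cU : U s x0 @[s --> tau0] --> U tau0 x0 :=
    @group_continuous _ _ _ _ UG x0 tau0.
  exact: cvg_comp tauF cU.
apply: (@cvg_rnorm_le _ _ _ _ _
  (fun i => rnorm (x i - x0) + rnorm (U (tau i) x0 - U tau0 x0))).
  move=> i; rewrite -(subrK (U (tau i) x0) (U (tau i) (x i))) -addrA.
  by rewrite (le_trans (rnormD _ _))// lerD2r -groupB rnorm_group.
rewrite -[0 in X in _ --> X](addr0 (0 : R)).
by apply: cvgD; exact: cvg_rnormB.
Qed.

(** Product rule: as U (b - t) = U (b - (t + h)) U h, the difference quotients of
    x and of U h (x t) are both carried by the isometry U (b - (t + h)). *)
Lemma hderiv_group b x t y g : hderiv x t y -> G (x t, g) ->
  hderiv (fun s => U (b - s) (x s)) t (U (b - t) (y - g)).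
Proof.
move=> xy /(group_generator UG) xg; rewrite /hderiv.
have h0 : b - (t + h) @[h --> 0^'] --> b - t.
  rewrite -[in X in _ --> X](addr0 t).
  apply: cvgB; first exact: cvg_cst.
  apply: cvgD; first exact: cvg_cst.
  exact: cvg_within.
apply: cvg_trans (cvg_group h0 (cvgB xy xg)); apply: near_eq_cvg; near=> h.
rewrite !fctE -scalerBr groupZ; congr (_ *: _); rewrite !groupB.
have -> : U (b - (t + h)) (U h (x t)) = U (b - t) (x t).
  by rewrite -(groupD UG); congr (U _ _); rewrite opprD addrA subrK.
by rewrite opprB addrA subrK.
Unshelve. all: by end_near. Qed.

(** Duhamel's formula, tested against the error w at time b: the function
    Re <w, U (b - t) (x t)> goes from Re <w, U (b - a) (x a)> to Re <w, x b>,
    and its derivative is at most |w| times the defect of x in the equation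
    of U. *)
Lemma duhamel_le x dx g a b eta : a <= b ->
  {within `[a, b], continuous x} ->
  (forall t, a < t < b ->
    [/\ hderiv x t (dx t), G (x t, g t) & rnorm (dx t - g t) <= eta]) ->
  rnorm (U (b - a) (x a) - x b) <= eta * (b - a).
Proof.
rewrite le_eqVlt => /predU1P[<- _ _|ab xc xd].
  by rewrite subrr (group0 UG) subrr rnorm0 mulr0.
set w := _ - _.
pose f t := rdot w (U (b - t) (x t)).
have [|t|c] := @MVT R f (fun t => rdot w (U (b - t) (dx t - g t))) a b ab.
- move=> t; rewrite in_itv/= => /xd[xt Gt _].
  exact/hderiv_rdot/hderiv_group.
- apply: cvg_rdot; apply: cvg_group; last exact: xc.
  apply: cvgB; first exact: cvg_cst.
  by apply: (@continuous_subspaceT _ _ `[a, b] id) => s; exact: cvg_id.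
rewrite in_itv/= => /xd[_ _ dxg].
have -> : f b - f a = - (rnorm w ^+ 2).
  by rewrite /f subrr (group0 UG) -rdotBr -rdotxx -rdotNr /w opprB.
have [-> _|w0] := eqVneq (rnorm w) 0.
  by rewrite mulr_ge0 ?subr_ge0 ?(ltW ab)// (le_trans (rnorm_ge0 _) dxg).
have wgt0 : 0 < rnorm w by rewrite lt0r w0 rnorm_ge0.
move=> fE; rewrite -(ler_pM2l wgt0) -expr2 -[leLHS]opprK fE -mulNr -rdotNr.
rewrite mulrA ler_wpM2r ?subr_ge0 ?(ltW ab)// (le_trans (rdot_le _ _))//.
by rewrite rnormN rnorm_group ler_wpM2l ?rnorm_ge0.
Qed.

End UnitaryGroup.

(** The product of f with the integrating factor exp (- c t) does not
    increase. *)
Lemma gronwall_le (R : realType) (f df : R -> R) (a b c : R) : a <= b ->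
  {within `[a, b], continuous f} ->
  (forall t, a < t < b -> is_derive t 1 f (df t) /\ df t <= c * f t) ->
  f b <= f a * expR (c * (b - a)).
Proof.
rewrite le_eqVlt => /predU1P[<- _ _|ab fc fd].
  by rewrite subrr mulr0 expR0 mulr1.
pose g t := f t * expR (- c * t).
have [|t|z] := @MVT R g (fun t => (df t - c * f t) * expR (- c * t)) a b ab.
- move=> t; rewrite in_itv/= => /fd[ft _].
  by apply: is_derive_eq; rewrite /GRing.scale/=; ring.
- apply: cvgM; first exact: fc.
  apply: (@continuous_subspaceT _ _ `[a, b] (fun t => expR (- c * t))) => s.
  apply: continuous_comp; last exact: continuous_expR.
  by apply: cvgM; [exact: cvg_cst|exact: cvg_id].
rewrite in_itv/= => /fd[_ dfc] gE.
have : g b <= g a.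
  rewrite -subr_le0 gE pmulr_lle0 ?subr_gt0// pmulr_lle0 ?expR_gt0//.
  by rewrite subr_le0.
rewrite /g -(ler_pM2r (expR_gt0 (c * b))) -!mulrA -!expRD.
by rewrite mulNr addNr expR0 mulr1 mulrBr mulNr addrC.
Qed.

Section EnergyDerivative.
Variables (R : realType) (H : hilbertSpace R).
Variables (phi : nat -> H) (lambda : nat -> R).
Hypothesis phi_on : forall i j, <[phi i, phi j]> = (i == j)%:R.
Implicit Types (x : R -> H) (t : R) (y z : H) (N : nat).

Local Notation proj := (galerkin_proj phi).

(** Tested against w = x b - pi_N (x b), which is orthogonal to the Galerkin
    space, the curve is constant; hence |w|^2 = 0. *)
Lemma hderiv_span N x dx a b : a <= b ->
  {within `[a, b], continuous x} ->
  (forall t, a < t < b -> hderiv x t (proj N (dx t))) ->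
  proj N (x a) = x a -> proj N (x b) = x b.
Proof.
move=> ab xc xd xa; set w := x b - proj N (x b).
have pw : proj N w = 0 by rewrite projD projN proj_idem// subrr.
have wproj z : rdot w (proj N z) = 0 by rewrite rdot_proj pw rdotC rdot0r.
have [||c _] := @MVT_segment R (fun t => rdot w (x t)) (fun=> 0) a b ab.
- move=> t; rewrite in_itv/= => /xd/hderiv_rdot-/(_ w).
  by rewrite wproj.
- exact: within_cvg_rdot.
rewrite mul0r -xa wproj subr0 -[x b](subrK (proj N (x b))) -/w.
rewrite rdotDr wproj addr0 rdotxx => /eqP; rewrite sqrf_eq0 => /eqP/rnorm_eq0.
by move=> w0; rewrite w0 add0r proj_idem.
Qed.

Definition galerkin_absA (k : R) N z : H :=
  \sum_(j < N) ((lambda j `^ k)%:C * <[phi j, z]>) *: phi j.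

Lemma inner_galerkin_absA k N z y :
  <[galerkin_absA k N z, y]> =
  \sum_(j < N) (lambda j `^ k)%:C * (Num.conj <[phi j, z]> * <[phi j, y]>).
Proof.
rewrite /galerkin_absA inner_suml; apply: eq_bigr => j _.
by rewrite innerZl rmorphM/= -mulrA conj_realC.
Qed.

Lemma inner_galerkin_absAxx k N z :
  <[galerkin_absA k N z, z]> = (energy phi lambda k N z)%:C.
Proof.
rewrite inner_galerkin_absA rmorph_sum; apply: eq_bigr => j _.
rewrite rmorphM/=; congr (_ * _); apply/eqP.
by rewrite sqr_rnorm eq_complex; case: <[phi j, z]> => u v/=; apply/andP; split;
  apply/eqP; ring.
Qed.

Lemma proj_galerkin_absA k N z :
  proj N (galerkin_absA k N z) = galerkin_absA k N z.
Proof.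
exact: (proj_lincomb phi_on (fun j => (lambda j `^ k)%:C * <[phi j, z]>)).
Qed.

Lemma Im_inner w z : complex.Im <[w, z]> = rdot ('i *: w) z.
Proof. by rewrite /rdot innerZl; case: <[w, z]> => u v/=; ring. Qed.

(** The energy as a sum of squares of real functionals, the real and imaginary
    parts of the coordinates. *)
Lemma energyE k N z : energy phi lambda k N z =
  \sum_(j < N) lambda j `^ k *
    (rdot (phi j) z * rdot (phi j) z +
     rdot ('i *: phi j) z * rdot ('i *: phi j) z).
Proof. by apply: eq_bigr => j _; rewrite sqr_rnorm Im_inner !expr2. Qed.

Lemma cvg_energy k N (T : Type) {F : set_system T} {FF : Filter F}
    (f : T -> H) z : f @ F --> z ->
  energy phi lambda k N (f i) @[i --> F] --> energy phi lambda k N z.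
Proof.
move=> fz; rewrite energyE; under eq_cvg do rewrite energyE.
apply: cvg_big => [|j _]; first exact: add_continuous.
by apply: cvgMr; apply: cvgD; apply: cvgM; exact: cvg_rdot.
Qed.

Lemma hderiv_energy k N x t y : hderiv x t y ->
  is_derive t 1 (fun s => energy phi lambda k N (x s))
    (2 * rdot (galerkin_absA k N (x t)) y).
Proof.
move=> xy.
pose F (j : 'I_N) s := lambda j `^ k *
  (rdot (phi j) (x s) * rdot (phi j) (x s) +
   rdot ('i *: phi j) (x s) * rdot ('i *: phi j) (x s)).
have -> : (fun s => energy phi lambda k N (x s)) = \sum_(j < N) F j.
  by apply/funext => s; rewrite fct_sumE energyE.
have Fd (j : 'I_N) : is_derive t 1 (F j) (lambda j `^ k * (2 *
    (rdot (phi j) (x t) * rdot (phi j) y +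
     rdot ('i *: phi j) (x t) * rdot ('i *: phi j) y))).
  have := hderiv_rdot (phi j) xy; have := hderiv_rdot ('i *: phi j) xy => d1 d2.
  by apply: is_derive_eq; rewrite /GRing.scale/=; ring.
apply: (@is_derive_eq _ _ _ _ _ _ _ _ (is_derive_sum Fd)).
rewrite /rdot inner_galerkin_absA raddf_sum mulr_sumr; apply: eq_bigr => j _.
rewrite mulrCA -!/(rdot _ _) -!Im_inner /rdot.
by case: <[phi j, x t]> => u v; case: <[phi j, y]> => u' v' /=; ring.
Qed.

End EnergyDerivative.

(** * The operators on Galerkin spaces *)

Section OperatorSums.
Variables (R : realType) (H : hilbertSpace R) (T : operator H).

Lemma op_fun0 : T 0 = 0.
Proof.
have := op_linear 1 (op_dom0 T) (op_dom0 T).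
by rewrite !scale1r addr0 => /eqP; rewrite -subr_eq subrr eq_sym => /eqP.
Qed.

Lemma op_funD x y : op_dom T x -> op_dom T y -> T (x + y) = T x + T y.
Proof. by move=> dx dy; have := op_linear 1 dx dy; rewrite !scale1r. Qed.

Lemma op_lincomb (e : nat -> H) (a : nat -> R[i]) n :
  (forall j, op_dom T (e j)) ->
  op_dom T (\sum_(j < n) a j *: e j) /\
  T (\sum_(j < n) a j *: e j) = \sum_(j < n) a j *: T (e j).
Proof.
move=> de; elim: n => [|n [ihd ihT]].
  by rewrite !big_ord0; split; [exact: op_dom0|exact: op_fun0].
rewrite !big_ord_recr/= addrC [in RHS]addrC -ihT.
by split; [exact: op_domP|exact: op_linear].
Qed.

End OperatorSums.

(** The reason is that lambda^(k - s) tends to infinity. *)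
Lemma powR_dominated (R : realType) (lambda : nat -> R) (s k : R) :
  (forall j, 0 < lambda j) ->
  (forall i j, (i <= j)%N -> lambda i <= lambda j) ->
  (forall M, exists j, M < lambda j) -> s < k ->
  forall e, 0 < e ->
  exists M, forall j, (M <= j)%N -> lambda j `^ s <= e * lambda j `^ k.
Proof.
move=> l0 lmono lunb sk e e0.
have [M ltM] := lunb (e^-1 `^ (k - s)^-1).
exists M => j Mj.
have ks : 0 < k - s by rewrite subr_gt0.
have : e^-1 <= lambda j `^ (k - s).
  rewrite -[leLHS]powRr1 ?invr_ge0 ?(ltW e0)// -(mulVf (lt0r_neq0 ks)) powRrM.
  apply: ge0_ler_powR; rewrite ?nnegrE ?powR_ge0 ?(ltW ks) ?(ltW (l0 j))//.
  exact: le_trans (ltW ltM) (lmono _ _ Mj).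
rewrite -(ler_pM2l e0) divff ?gt_eqF// => h.
rewrite -[leLHS]mul1r -[k in leRHS](subrK s).
rewrite powRD ?(lt0r_neq0 (l0 j)) ?implybT//.
by rewrite mulrA ler_wpM2r ?powR_ge0.
Qed.

Section Galerkin.
Variables (R : realType) (H : hilbertSpace R) (p : nat).
Variables (A : operator H) (B : 'I_p -> operator H).
Variables (phi : nat -> H) (lambda : nat -> R) (k r d : R).
Hypothesis hii : condition_ii A phi lambda.
Hypotheses (rk : r < k) (d0 : 0 < d).
Hypothesis hB : forall l psi, absA_dom phi lambda (r / 2) psi ->
  op_dom (B l) psi /\ rnorm (B l psi) <= d * absA_norm phi lambda (r / 2) psi.

Local Notation proj := (galerkin_proj phi).
Local Notation en := (energy phi lambda).

Let phi_on : forall i j, <[phi i, phi j]> = (i == j)%:R.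
Proof. by have [] := ii_basis hii. Qed.

Let lambda_gt0 := ii_positive hii.

Lemma cvg_proj x : rnorm (x - proj N x) @[N --> \oo] --> (0 : R).
Proof.
have [_ /(_ x)/cvg_rnormB] := ii_basis hii.
apply: cvg_trans; apply: near_eq_cvg; apply: nearW => N /=.
by rewrite rnorm_distC /series/= big_mkord.
Qed.

Lemma opA_span N z : proj N z = z ->
  op_dom A z /\
  A z = \sum_(j < N) (<[phi j, z]> * (- 'i * (lambda j)%:C)) *: phi j.
Proof.
move=> zN; rewrite -{1 2}zN /galerkin_proj.
have [] := @op_lincomb _ _ A phi (fun j => <[phi j, z]>) N.
  by move=> j; have [] := ii_eigen hii j.
move=> dz ->; split=> //; apply: eq_bigr => j _.
by have [_ ->] := ii_eigen hii j; rewrite scalerA.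
Qed.

Lemma proj_opA N z : proj N z = z -> proj N (A z) = A z.
Proof.
move=> /opA_span[_ ->].
exact: (proj_lincomb phi_on (fun j => <[phi j, z]> * (- 'i * (lambda j)%:C))).
Qed.

(** Coordinate z_j contributes lambda_j^k |z_j|^2 times - i lambda_j, which is
    imaginary. *)
Lemma rdot_galerkin_absA_opA N z : proj N z = z ->
  rdot (galerkin_absA phi lambda k N z) (A z) = 0.
Proof.
move=> zN; have [_ ->] := opA_span zN.
rewrite rdot_sumr big1// => j _; rewrite /rdot innerZr.
rewrite /galerkin_absA inner_suml (bigD1 j)//= big1 ?addr0 => [|i ij].
  rewrite innerZl phi_on eqxx mulr1 rmorphM/= conj_realC.
  by case: <[phi j, z]> => u v/=; ring.
by rewrite innerZl phi_on (_ : _ == _ = false) ?mulr0//; apply/negbTE.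
Qed.

Lemma opB_span l N z : proj N z = z -> op_dom (B l) z.
Proof.
by move=> zN; have [] := hB l (absA_dom_span lambda phi_on (r / 2) zN).
Qed.

(** The part of z below M is a combination of finitely many basis vectors, to
    which B_l is applied one by one; the rest is small in the norm of order
    r / 2, and 1 - pi_N does not increase norms. *)
Lemma rnorm_compl_opB l M N z : proj N z = z ->
  rnorm (B l z - proj N (B l z)) <=
  \sum_(j < M) rnorm <[phi j, z]> * rnorm (B l (phi j) - proj N (B l (phi j))) +
  d * absA_norm phi lambda (r / 2) (z - proj M z).
Proof.
move=> zN; set y := z - proj M z.
have domphi j : op_dom (B l) (phi j) by exact: opB_span (proj_phi phi_on j).
have [domM BM] := @op_lincomb _ _ (B l) phi (fun j => <[phi j, z]>) M domphi.
have [ydom By] : op_dom (B l) y /\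
    rnorm (B l y) <= d * absA_norm phi lambda (r / 2) y.
  apply: hB; apply: (@absA_dom_span _ _ _ _ phi_on _ (maxn M N)).
  rewrite projD projN (proj_widen phi_on (leq_maxr M N) zN).
  by rewrite (proj_widen phi_on (leq_maxl M N))// proj_idem.
have -> : B l z = B l y + \sum_(j < M) <[phi j, z]> *: B l (phi j).
  by rewrite -BM -op_funD// subrK.
rewrite projD opprD addrACA addrC (le_trans (rnormD _ _))// lerD//; last first.
  exact: le_trans (rnorm_compl_le phi_on _ _) By.
rewrite proj_sum -sumrB (le_trans (rnorm_sum _ _ _))//.
by apply: ler_sum => j _; rewrite projZ -scalerBr rnormZ.
Qed.

(** Balls of the norm of order k / 2 are relatively compact for the norm of
    order r / 2, hence B_l maps them to relatively compact sets, on which the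
    projections converge uniformly.  Compactness appears as the choice of M
    before N: beyond M the norm of order r / 2 is small, and below M only
    finitely many vectors B_l phi_j have to be approximated. *)
Lemma near_compl_opB E eta : 0 <= E -> 0 < eta ->
  \forall N \near \oo, forall l z, proj N z = z -> en k N z <= E ->
    rnorm (B l z - proj N (B l z)) <= eta.
Proof.
move=> E0 eta0.
(* This e makes the tail contribute at most d * sqrt (e * E) <= eta / 2. *)
pose e := (eta / (2 * d)) ^+ 2 / (E + 1).
have E1 : 0 < E + 1 by rewrite ltr_wpDl.
have e0 : 0 < e by rewrite divr_gt0// exprn_gt0// divr_gt0// mulr_gt0.
have [M Mdom] := powR_dominated lambda_gt0 (ii_nondecreasing hii)
  (ii_unbounded hii) rk e0.
(* m j bounds the j-th coordinate of the vectors of energy at most E. *)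
pose m (j : nat) := Num.sqrt (E / lambda j `^ k).
have lim0 l : \sum_(j < M) m j * rnorm (B l (phi j) - proj N (B l (phi j)))
    @[N --> \oo] --> (0 : R).
  rewrite -[X in _ --> X](_ : \sum_(j < M) m j * 0 = 0); last first.
    by apply: big1 => j _; rewrite mulr0.
  apply: cvg_big => [|j _]; last by apply: cvgMr; exact: cvg_proj.
  exact: add_continuous.
have eta2 : 0 < eta / 2 by rewrite divr_gt0.
have : \forall N \near \oo, forall l : 'I_p,
    `|\sum_(j < M) m j * rnorm (B l (phi j) - proj N (B l (phi j))) - 0| <
    eta / 2.
  by apply: filter_forall => l; have /cvgrPdistC_lt/(_ _ eta2) := lim0 l.
apply: filterS => N small l z zN zE.
have coordE j : rnorm <[phi j, z]> <= m j.
  rewrite /m -(ger0_norm (rnorm_ge0 _)) -sqrtr_sqr ler_wsqrtr//.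
  rewrite ler_pdivlMr ?powR_gt0// mulrC.
  apply: le_trans (_ : en k j.+1 z <= E).
    by rewrite /energy big_ord_recr/= lerDr energy_ge0.
  exact: le_trans (energy_span lambda phi_on _ _ _) zE.
rewrite (le_trans (rnorm_compl_opB l M zN))// [eta]splitr lerD//.
  have := ltW (small l); rewrite subr0; apply: le_trans.
  rewrite (le_trans _ (ler_norm _))//; apply: ler_sum => j _.
  by rewrite ler_wpM2r ?rnorm_ge0.
rewrite -ler_pdivlMl// -[leRHS]ger0_norm; last first.
  by rewrite mulr_ge0 ?invr_ge0 ?divr_ge0 ?ltW.
have wE P : en r P (z - proj M z) <= e * E.
  apply: le_trans (energy_split phi P (z - proj M z) Mdom (ltW e0)) _.
  rewrite {1}/energy big1 ?add0r => [|j _]; last first.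
    by rewrite innerBr coord_proj// ltn_ord subrr rnorm0 expr0n mulr0.
  rewrite ler_wpM2l ?(ltW e0)// (le_trans _ zE)//.
  apply: le_trans (_ : en k P z <= _); last exact: energy_span.
  apply: ler_sum => j _; rewrite innerBr coord_proj//; case: ifP => _.
    by rewrite subrr rnorm0 expr0n mulr0 energy_term_ge0.
  by rewrite subr0.
rewrite -sqrtr_sqr -[leLHS]ger0_norm ?rnorm_ge0// -sqrtr_sqr ler_wsqrtr//.
rewrite (le_trans (absA_norm_le phi_on lambda_gt0 wE))//.
rewrite /e mulrAC ler_pdivrMr//.
have -> : d^-1 * (eta / 2) = eta / (2 * d) by field; rewrite gt_eqF.
by rewrite ler_wpM2l ?sqr_ge0// lerDl.
Qed.

End Galerkin.

(** * Galerkin solutions under a constant control *)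

Section ConstantControl.
Variables (R : realType) (H : hilbertSpace R) (p : nat).
Variables (A : operator H) (B : 'I_p -> operator H).
Variables (phi : nat -> H) (lambda : nat -> R) (k C : R).
Hypothesis hii : condition_ii A phi lambda.
Hypothesis hC : forall l psi, absA_dom phi lambda k psi ->
  op_dom (B l) psi /\
  `|complex.Re <[absA phi lambda k psi, B l psi]>| <=
    C * rnorm <[absA phi lambda k psi, psi]>.

Local Notation proj := (galerkin_proj phi).
Local Notation en := (energy phi lambda).

Let phi_on : forall i j, <[phi i, phi j]> = (i == j)%:R.
Proof. by have [] := ii_basis hii. Qed.

Let lambda_gt0 := ii_positive hii.

Lemma weak_coupling_span l N z : proj N z = z ->
  `|rdot (galerkin_absA phi lambda k N z) (B l z)| <= `|C| * en k N z.
Proof.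
move=> zN; have [_] := hC l (absA_dom_span lambda phi_on k zN).
rewrite (absA_span lambda phi_on k zN) -/(galerkin_absA phi lambda k N z).
rewrite inner_galerkin_absAxx rnorm_real (ger0_norm (energy_ge0 _ _ _ _ _)).
move=> /le_trans; apply.
by rewrite ler_wpM2r ?energy_ge0// ler_norm.
Qed.

Definition drift (v : 'I_p -> R) (z : H) : H :=
  A z + \sum_l (v l)%:C *: B l z.

Definition ctrl_size (v : 'I_p -> R) : R := \sum_l `|v l|.

Lemma ctrl_size_ge0 v : 0 <= ctrl_size v.
Proof. by apply: sumr_ge0. Qed.

Lemma galerkin_drift N v z :
  galerkin_op phi N A z + \sum_l (v l)%:C *: galerkin_op phi N (B l) z =
  proj N (drift v (proj N z)).
Proof.
rewrite /galerkin_op /drift projD proj_sum; congr (_ + _).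
by apply: eq_bigr => l _; rewrite projZ.
Qed.

Lemma closure_perturbed v N z : proj N z = z ->
  closure (perturbed A B v) (z, drift v z).
Proof.
move=> zN; apply: subset_closure; split=> //=.
by have [] := opA_span hii zN.
Qed.

Section Interval.
Variables (N : nat) (v : 'I_p -> R) (x : R -> H) (a b : R).
Hypothesis ab : a <= b.
Hypothesis xc : {within `[a, b], continuous x}.
Hypothesis xd : forall t, a < t < b ->
  hderiv x t (proj N (drift v (proj N (x t)))).
Hypothesis xa : proj N (x a) = x a.

Let sub_within t : t <= b -> {within `[a, t], continuous x}.
Proof.
move=> tb; apply: continuous_subspaceW xc; apply: subset_itvl.
by rewrite bnd_simp.
Qed.

Lemma galerkin_span t : a <= t <= b -> proj N (x t) = x t.
Proof.
move=> /andP[at_ tb]; apply: (hderiv_span phi_on at_ (sub_within tb)) => // s.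
by move=> /andP[as_ st]; apply: xd; rewrite as_ (lt_le_trans st tb).
Qed.

(** On the Galerkin space A does not change the energy, and by weak coupling
    the control makes it grow at a relative rate of at most 2 |C| |v|. *)
Lemma galerkin_energy t : a <= t <= b ->
  en k N (x t) <= en k N (x a) * expR (2 * `|C| * ctrl_size v * (t - a)).
Proof.
move=> /andP[at_ tb].
apply: (@gronwall_le R (fun s => en k N (x s)) (fun s =>
  2 * rdot (galerkin_absA phi lambda k N (x s)) (proj N (drift v (x s))))
  a t _ at_).
  by move=> s; apply: cvg_energy; exact: sub_within.
move=> s /andP[as_ st].
have sab : a < s < b by rewrite as_ (lt_le_trans st tb).
have xs : proj N (x s) = x s.
  by apply: galerkin_span; move: sab => /andP[/ltW-> /ltW->].
split; first by apply: hderiv_energy; have := xd sab; rewrite xs.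
rewrite rdot_proj proj_galerkin_absA// /drift rdotDr.
rewrite (rdot_galerkin_absA_opA k hii xs) add0r rdot_sumr.
rewrite -!mulrA ler_wpM2l// mulrCA /ctrl_size mulr_suml.
apply: ler_sum => l _; rewrite rdotZr (le_trans (ler_norm _))// normrM.
by rewrite ler_wpM2l// weak_coupling_span.
Qed.

Variables (E eta : R) (U : R -> H -> H).
Hypothesis UG : unitary_group_of (closure (perturbed A B v)) U.
Hypothesis enE : en k N (x a) * expR (2 * `|C| * ctrl_size v * (b - a)) <= E.
Hypothesis compl_eta : forall l z, proj N z = z -> en k N z <= E ->
  rnorm (B l z - proj N (B l z)) <= eta.

(** As A preserves the Galerkin space, the defect of a Galerkin solution z in
    the exact equation is the part of sum_l v_l B_l z outside that space. *)
Lemma galerkin_error :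
  rnorm (U (b - a) (x a) - x b) <= eta * (ctrl_size v * (b - a)).
Proof.
rewrite mulrA; apply: (duhamel_le UG (dx := fun t => proj N (drift v (x t)))
  (g := fun t => drift v (x t))) => // t tab.
have tab' : a <= t <= b by move: tab => /andP[/ltW-> /ltW->].
have xt := galerkin_span tab'.
split; [by have := xd tab; rewrite xt|exact: closure_perturbed xt|].
have xE : en k N (x t) <= E.
  rewrite (le_trans (galerkin_energy tab'))// (le_trans _ enE)//.
  rewrite ler_wpM2l ?energy_ge0// ler_expR ler_wpM2l//.
    by rewrite mulr_ge0 ?mulr_ge0 ?ctrl_size_ge0.
  by rewrite lerB//; case/andP: tab'.
rewrite rnorm_distC /drift projD (proj_opA hii xt) proj_sum.
rewrite opprD addrACA subrr add0r -sumrB (le_trans (rnorm_sum _ _ _))//.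
rewrite mulrC /ctrl_size mulr_suml; apply: ler_sum => l _.
by rewrite projZ -scalerBr rnormZ rnorm_real ler_wpM2l// compl_eta.
Qed.

End Interval.
End ConstantControl.

(** * Piecewise constant controls *)

Section PiecewiseControl.
Variables (R : realType) (p : nat) (u : pw_control R p).
Implicit Types (t : R) (l : 'I_p).

Lemma tm_mono i j :
  (i <= j)%N -> (j <= (last_piece u).+1)%N -> tm u i <= tm u j.
Proof.
move=> ij; rewrite -(subnKC ij); elim: (j - i)%N => [|n ih] jN.
  by rewrite addn0.
rewrite addnS in jN *; apply: le_trans (ih (ltnW jN)) _.
exact: tm_le.
Qed.

Lemma tm_ge0 j : (j <= (last_piece u).+1)%N -> 0 <= tm u j.
Proof. by rewrite -(tm0 u); exact: tm_mono. Qed.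

(** The pieces are disjoint. *)
Lemma step_sumE (c : nat -> R) n t : (n <= last_piece u)%N ->
  tm u n <= t < tm u n.+1 ->
  \sum_(i < (last_piece u).+1) c i * \1_(`[tm u i, tm u i.+1[) t = c n.
Proof.
move=> nN tn.
have nN' : (n < (last_piece u).+1)%N by [].
have tin : \1_(`[tm u n, tm u n.+1[) t = 1 :> R.
  by rewrite indicE mem_set//= in_itv/= tn.
rewrite (bigD1 (Ordinal nN'))//= tin mulr1 big1 ?addr0//.
move=> i; rewrite -val_eqE/= => ni; rewrite indicE memNset ?mulr0//= in_itv/=.
move: tn => /andP[nt tn] /andP[it ti].
move: ni; rewrite neq_ltn => /orP[] lt.
  by have := tm_mono lt (leqW nN); rewrite leNgt (le_lt_trans nt ti).
by have := tm_mono lt (ltnW (ltn_ord i)); rewrite leNgt (le_lt_trans it tn).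
Qed.

Lemma step_sum0 (c : nat -> R) t :
  (forall n, (n <= last_piece u)%N -> ~~ (tm u n <= t < tm u n.+1)) ->
  \sum_(i < (last_piece u).+1) c i * \1_(`[tm u i, tm u i.+1[) t = 0.
Proof.
move=> nt; apply: big1 => i _; rewrite indicE memNset ?mulr0//=.
by apply/negP; rewrite in_itv/=; apply: nt; rewrite -ltnS.
Qed.

Lemma control_fun_piece l n t : (n <= last_piece u)%N ->
  tm u n <= t < tm u n.+1 -> control_fun u l t = val u n l.
Proof. exact: (step_sumE (fun n => val u n l)). Qed.

Lemma control_fun_after l t :
  tm u (last_piece u).+1 <= t -> control_fun u l t = 0.
Proof.
move=> tN; apply: (step_sum0 (fun n => val u n l)) => n nN.
apply/negP => /andP[_]; apply/negP; rewrite -leNgt.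
apply: le_trans tN; exact: tm_mono.
Qed.

(** As the pieces are disjoint, the absolute value passes inside the sum. *)
Lemma norm_control_fun l t : `|control_fun u l t| =
  \sum_(i < (last_piece u).+1) `|val u i l| * \1_(`[tm u i, tm u i.+1[) t.
Proof.
have [[n [nN tn]]|none] := pselect (exists n, (n <= last_piece u)%N /\
    tm u n <= t < tm u n.+1).
  rewrite (control_fun_piece _ nN tn).
  by rewrite (step_sumE (fun n => `|val u n l|) nN tn).
have nt n : (n <= last_piece u)%N -> ~~ (tm u n <= t < tm u n.+1).
  by move=> nN; apply/negP => tn; apply: none; exists n.
by rewrite (step_sum0 (fun n => `|val u n l|) nt) /control_fun
  (step_sum0 (fun n => val u n l) nt) normr0.
Qed.

Lemma control_L1E l : control_L1 u l =
  (\sum_(i < (last_piece u).+1) `|val u i l| * (tm u i.+1 - tm u i))%:E.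
Proof.
have mD : measurable (`[0%R, +oo[ : set R) by exact: measurable_itv.
have mI (i : nat) : measurable_fun (`[0%R, +oo[ : set R)
    (\1_(`[tm u i, tm u i.+1[) : R -> R).
  exact: measurable_indic.
rewrite /control_L1; under eq_integral do
  rewrite norm_control_fun -sumEFin; under eq_integral do
  under eq_bigr do rewrite EFinM.
rewrite ge0_integral_sum//=; last first.
  move=> i; apply: emeasurable_funM; first exact: measurable_cst.
  exact: (iffRL (measurable_EFinP _ _) (mI i)).
rewrite -sumEFin; apply: eq_bigr => i _.
rewrite ge0_integralZl_EFin//; last first.
  exact: (iffRL (measurable_EFinP _ _) (mI i)).
rewrite integral_indic// setIidl; last first.
  move=> t /=; rewrite !in_itv/= andbT => /andP[+ _]; apply: le_trans.
  by apply: tm_ge0; rewrite ltnW.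
rewrite EFinM; congr (_ * _)%E.
apply: etrans (lebesgue_measure_itv _) _; rewrite /= lte_fin EFinB.
case: ltgtP (tm_le (ltn_ord i : (i <= last_piece u)%N)) => // -> _.
by rewrite subee.
Qed.

(** The L1-norm of the control over its first n pieces, restricted to times
    before T. *)
Definition spent (T : R) (n : nat) : R :=
  \sum_(i < n) ctrl_size (val u i) * (Num.min T (tm u i.+1) - Num.min T (tm u i)).

Lemma spent_le T n (K : R) : (n <= (last_piece u).+1)%N ->
  (\sum_(l < p) control_L1 u l < K%:E)%E -> spent T n <= K.
Proof.
move=> nN uK.
have minB (i : 'I_n) : 0 <= Num.min T (tm u i.+1) - Num.min T (tm u i)
    <= tm u i.+1 - tm u i.
  have := tm_le (leq_trans (ltn_ord i) nN).
  rewrite !minEle; case: (leP T (tm u i.+1)) => ?; case: (leP T (tm u i)) => ? ?;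
    by apply/andP; split; lra.
apply: ltW; rewrite -lte_fin; apply: le_lt_trans uK.
under eq_bigr do rewrite control_L1E.
rewrite sumEFin lee_fin exchange_big/=.
apply: (@le_trans _ _ (\sum_(i < n) ctrl_size (val u i) * (tm u i.+1 - tm u i))).
  apply: ler_sum => i _; rewrite ler_wpM2l ?ctrl_size_ge0//.
  by have /andP[] := minB i.
rewrite -(big_mkord xpredT (fun i => ctrl_size (val u i) * (tm u i.+1 - tm u i))).
rewrite -(big_mkord xpredT
  (fun i => \sum_(l < p) `|val u i l| * (tm u i.+1 - tm u i))).
rewrite [leRHS](big_cat_nat _ (n:=n))//= -[leLHS]addr0 lerD//.
  by apply: ler_sum => i _; rewrite /ctrl_size mulr_suml.
rewrite big_nat; apply: sumr_ge0 => i /andP[_ iN]; apply: sumr_ge0 => l _.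
by rewrite mulr_ge0// subr_ge0 tm_le.
Qed.

End PiecewiseControl.

(** * Comparison with the exact propagator *)

Section Approximation.
Variables (R : realType) (H : hilbertSpace R) (p : nat).
Variables (A : operator H) (B : 'I_p -> operator H).
Variables (phi : nat -> H) (lambda : nat -> R).
Variable (e : ('I_p -> R) -> R -> H -> H).
Variable (X : nat -> pw_control R p -> R -> R -> H -> H).
Variables (k C : R).
Hypothesis hii : condition_ii A phi lambda.
Hypothesis hC : forall l psi, absA_dom phi lambda k psi ->
  op_dom (B l) psi /\
  `|complex.Re <[absA phi lambda k psi, B l psi]>| <=
    C * rnorm <[absA phi lambda k psi, psi]>.
Hypothesis he : forall v, unitary_group_of (closure (perturbed A B v)) (e v).
Hypothesis hX : forall N u, galerkin_propagator A B phi N u (X N u).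

Local Notation proj := (galerkin_proj phi).
Local Notation en := (energy phi lambda).

Let phi_on : forall i j, <[phi i, phi j]> = (i == j)%:R.
Proof. by have [] := ii_basis hii. Qed.

Section FixedControl.
Variables (N : nat) (u : pw_control R p) (psi : H).

Let x t := X N u t 0 (proj N psi).

Let x0 : x 0 = proj N psi.
Proof. by have [] := hX N u (proj N psi) (lexx 0). Qed.

Lemma galerkin_path_continuous a b : 0 <= a -> {within `[a, b], continuous x}.
Proof.
move=> a0; have [_ xc _] := hX N u (proj N psi) (lexx 0).
apply: continuous_subspaceW xc => t /=; rewrite !in_itv/= andbT => /andP[+ _].
exact: le_trans.
Qed.

Lemma galerkin_path_hderiv v t : 0 < t ->
  (forall n, (n <= (last_piece u).+1)%N -> t != tm u n) ->
  (forall l, control_fun u l t = v l) ->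
  hderiv x t (proj N (drift A B v (proj N (x t)))).
Proof.
move=> t0 tn uv; have [_ _ /(_ t t0 tn)] := hX N u (proj N psi) (lexx 0).
rewrite (eq_bigr (fun l => (v l)%:C *: galerkin_op phi N (B l) (x t))).
  by rewrite galerkin_drift.
by move=> l _; rewrite uv.
Qed.

Variable (T : R).
Hypothesis T0 : 0 <= T.

Let a n := Num.min T (tm u n).

Let a_ge0 n : (n <= (last_piece u).+1)%N -> 0 <= a n.
Proof. by move=> nN; rewrite le_min T0 tm_ge0. Qed.

Let a_mono n : (n <= last_piece u)%N -> a n <= a n.+1.
Proof.
move=> nN; rewrite le_min ge_min lexx/= ge_min; apply/orP; right.
exact: tm_le.
Qed.

Let piece_hderiv n t : (n <= last_piece u)%N -> a n < t < a n.+1 ->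
  hderiv x t (proj N (drift A B (val u n) (proj N (x t)))).
Proof.
move=> nN /andP[]; rewrite gt_min lt_min => + /andP[tT tn1].
rewrite ltNge (ltW tT)/= => nt.
apply: galerkin_path_hderiv.
- exact: le_lt_trans (tm_ge0 (leqW nN)) nt.
- move=> i iN; apply/eqP => ti; have [ni|ni] := ltnP n i.
    by have := tm_mono ni iN; rewrite leNgt -ti tn1.
  by have := tm_mono ni (leqW nN); rewrite leNgt -ti nt.
- by move=> l; apply: control_fun_piece => //; rewrite (ltW nt).
Qed.

Let last_hderiv t : a (last_piece u).+1 < t < T ->
  hderiv x t (proj N (drift A B (fun=> 0) (proj N (x t)))).
Proof.
move=> /andP[]; rewrite gt_min => + tT; rewrite ltNge (ltW tT)/= => nt.
apply: galerkin_path_hderiv.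
- exact: le_lt_trans (tm_ge0 (leqnn _)) nt.
- move=> i iN; apply/eqP => ti.
  by have := tm_mono iN (leqnn _); rewrite leNgt -ti nt.
- by move=> l; apply: control_fun_after; exact: ltW.
Qed.

Variables (K E eta : R).
Hypothesis uK : (\sum_(l < p) control_L1 u l < K%:E)%E.
Hypothesis psiE : en k N psi * expR (2 * `|C| * K) <= E.
Hypothesis eta0 : 0 <= eta.

Let spentS n :
  spent u T n.+1 = spent u T n + ctrl_size (val u n) * (a n.+1 - a n).
Proof. by rewrite /spent big_ord_recr. Qed.

Let expR_spentS n : expR (2 * `|C| * spent u T n.+1) =
  expR (2 * `|C| * spent u T n) *
  expR (2 * `|C| * ctrl_size (val u n) * (a n.+1 - a n)).
Proof. by rewrite spentS -expRD; congr expR; ring. Qed.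

Let energy_spent n : (n <= (last_piece u).+1)%N ->
  en k N psi * expR (2 * `|C| * spent u T n) <= E.
Proof.
move=> nN; apply: le_trans psiE; rewrite ler_wpM2l ?energy_ge0// ler_expR.
by rewrite ler_wpM2l ?mulr_ge0// (spent_le T nN uK).
Qed.

(** The growth factors of successive pieces multiply, so that only the total
    size of the control matters. *)
Lemma galerkin_path_energy n : (n <= (last_piece u).+1)%N ->
  proj N (x (a n)) = x (a n) /\
  en k N (x (a n)) <= en k N psi * expR (2 * `|C| * spent u T n).
Proof.
elim: n => [|n ih] nN.
  have -> : a 0 = 0 by rewrite /a tm0; exact/min_idPr.
  rewrite x0 /spent big_ord0 mulr0 expR0 mulr1 energy_proj//.
  by rewrite proj_idem.
have [xn En] := ih (ltnW nN).
have an := a_mono nN.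
have an1 : a n <= a n.+1 <= a n.+1 by rewrite an lexx.
have xc := @galerkin_path_continuous _ (a n.+1) (a_ge0 (ltnW nN)).
have xd t := @piece_hderiv n t nN.
split; first exact: (galerkin_span hii xc xd xn an1).
apply: le_trans (galerkin_energy hii hC xc xd xn an1) _.
by rewrite expR_spentS mulrA ler_wpM2r ?expR_ge0.
Qed.

Hypothesis compl_eta : forall l z, proj N z = z -> en k N z <= E ->
  rnorm (B l z - proj N (B l z)) <= eta.

(** A piece carries the previous error along isometrically and adds its own. *)
Lemma propagator_pieces_error n : (n <= (last_piece u).+1)%N ->
  rnorm (propagator_pieces e u T n psi - x (a n)) <=
    rnorm (psi - proj N psi) + eta * spent u T n.
Proof.
elim: n => [|n ih] nN.
  have -> : a 0 = 0 by rewrite /a tm0; exact/min_idPr.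
  by rewrite x0 /= /spent big_ord0 mulr0 addr0.
have [xn En] := galerkin_path_energy (ltnW nN).
have an := a_mono nN.
have xc := @galerkin_path_continuous _ (a n.+1) (a_ge0 (ltnW nN)).
have xd t := @piece_hderiv n t nN.
have enE : en k N (x (a n)) *
    expR (2 * `|C| * ctrl_size (val u n) * (a n.+1 - a n)) <= E.
  apply: le_trans (energy_spent nN).
  by rewrite expR_spentS mulrA ler_wpM2r ?expR_ge0.
have err := galerkin_error hii hC an xc xd xn (he _) enE compl_eta.
rewrite [propagator_pieces _ _ _ _ _]/= -/(a n) -/(a n.+1).
rewrite -(subrK (e (val u n) (a n.+1 - a n) (x (a n))) (e _ _ _)) -addrA.
rewrite (le_trans (rnormD _ _))// spentS mulrDr addrA lerD//.
by rewrite -(groupB (he _)) (rnorm_group (he _)) ih// ltnW.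
Qed.

Lemma galerkin_span_energy :
  proj N (x T) = x T /\ en k N (x T) <= E.
Proof.
have N1 := leqnn (last_piece u).+1.
have [xn En] := galerkin_path_energy N1.
have aT : a (last_piece u).+1 <= T by rewrite ge_min lexx.
have aTT : a (last_piece u).+1 <= T <= T by rewrite aT lexx.
have xc := @galerkin_path_continuous _ T (a_ge0 N1).
split; first exact: (galerkin_span hii xc last_hderiv xn aTT).
apply: le_trans (galerkin_energy hii hC xc last_hderiv xn aTT) _.
rewrite (_ : ctrl_size _ = 0); last by apply: big1 => l _; rewrite normr0.
by rewrite mulr0 mul0r expR0 mulr1 (le_trans En)// energy_spent.
Qed.

Lemma propagator_error :
  rnorm (propagator e u T psi - x T) <= rnorm (psi - proj N psi) + eta * K.
Proof.
have N1 := leqnn (last_piece u).+1.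
have [xn En] := galerkin_path_energy N1.
have aT : a (last_piece u).+1 <= T by rewrite ge_min lexx.
have xc := @galerkin_path_continuous _ T (a_ge0 N1).
have c0 : @ctrl_size R p (fun=> 0) = 0 by apply: big1 => l _; rewrite normr0.
have enE : en k N (x (a (last_piece u).+1)) *
    expR (2 * `|C| * @ctrl_size R p (fun=> 0) * (T - a (last_piece u).+1)) <= E.
  by rewrite c0 mulr0 mul0r expR0 mulr1 (le_trans En)// energy_spent.
have err := galerkin_error hii hC aT xc last_hderiv xn (he _) enE compl_eta.
move: err; rewrite c0 mul0r mulr0 => err.
rewrite /propagator -/(a _).
set y := propagator_pieces _ _ _ _ _.
rewrite -(subrK (e (fun=> 0) (T - a (last_piece u).+1) (x (a (last_piece u).+1)))
  (e _ _ y)) -addrA (le_trans (rnormD _ _))// -[leRHS]addr0 lerD//.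
rewrite -(groupB (he _)) (rnorm_group (he _)).
rewrite (le_trans (propagator_pieces_error N1))// lerD2l ler_wpM2l//.
exact: spent_le N1 uK.
Qed.

End FixedControl.

Variables (r d : R).
Hypotheses (rk : r < k) (d0 : 0 < d).
Hypothesis hB : forall l psi, absA_dom phi lambda (r / 2) psi ->
  op_dom (B l) psi /\ rnorm (B l psi) <= d * absA_norm phi lambda (r / 2) psi.

Section FixedDatum.
Variables (psi : H) (S K : R).
Hypothesis psiS : forall N, en k N psi <= S.
Hypothesis K0 : 0 <= K.

Local Notation delta N u T :=
  (propagator e u T psi - X N u T 0 (proj N psi)).

Let E := S * expR (2 * `|C| * K).

Let psiE N : en k N psi * expR (2 * `|C| * K) <= E.
Proof. by rewrite ler_wpM2r ?expR_ge0. Qed.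

Let E0 : 0 <= E.
Proof. by apply: le_trans (psiE 0); rewrite mulr_ge0 ?energy_ge0 ?expR_ge0. Qed.

Lemma near_propagator_norm eta : 0 < eta ->
  \forall N \near \oo, forall u, (\sum_(l < p) control_L1 u l < K%:E)%E ->
    forall T, 0 <= T -> rnorm (delta N u T) <= eta.
Proof.
(* Half of eta is for the initial datum, half for the defect over all pieces. *)
move=> eta0; pose eta1 := eta / 2 / (K + 1).
have K1 : 0 < K + 1 by rewrite ltr_wpDl.
have eta2 : 0 < eta / 2 by rewrite divr_gt0.
have eta10 : 0 < eta1 by rewrite divr_gt0.
have := near_compl_opB hii rk d0 hB E0 eta10.
have /cvgrPdistC_lt/(_ _ eta2) := cvg_proj hii psi.
apply: filterS2 => N; rewrite subr0 => /(le_lt_trans (ler_norm _)) psiN BN.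
move=> u uK T T0.
apply: le_trans (propagator_error T0 uK (psiE N) (ltW eta10) BN) _.
rewrite [leRHS]splitr lerD ?(ltW psiN)// /eta1 mulrAC ler_pdivrMr//.
by rewrite ler_wpM2l ?(ltW eta2)// lerDl.
Qed.

(* Finitely many coordinates are controlled by the norm of H. *)
Let small_energy s M c z : 0 < c ->
  rnorm z <= Num.sqrt (c / (1 + \sum_(j < M) lambda j `^ s)) -> en s M z <= c.
Proof.
move=> c0 zc; have s0 : 0 <= \sum_(j < M) lambda j `^ s.
  by apply: sumr_ge0 => j _; exact: powR_ge0.
have s1 : 0 < 1 + \sum_(j < M) lambda j `^ s by rewrite ltr_pwDl.
apply: le_trans (energy_le_norm lambda phi_on s M z) _.
apply: (@le_trans _ _ ((\sum_(j < M) lambda j `^ s) *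
    (c / (1 + \sum_(j < M) lambda j `^ s)))).
  rewrite ler_wpM2l// -[leRHS]sqr_sqrtr ?divr_ge0 ?(ltW c0) ?(ltW s1)//.
  by rewrite lerXn2r ?nnegrE ?rnorm_ge0 ?sqrtr_ge0.
by rewrite mulrCA -[leRHS]mulr1 ler_wpM2l ?(ltW c0)// ler_pdivrMr// mul1r lerDr.
Qed.

Let near_propagator_small_energy s M c : 0 < c ->
  \forall N \near \oo, forall u, (\sum_(l < p) control_L1 u l < K%:E)%E ->
    forall T, 0 <= T -> en s M (delta N u T) <= c.
Proof.
move=> c0; have [|] := @near_propagator_norm
    (Num.sqrt (c / (1 + \sum_(j < M) lambda j `^ s))).
  rewrite sqrtr_gt0 divr_gt0// ltr_pwDl// sumr_ge0// => j _.
  exact: powR_ge0.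
move=> N0 _ NN; exists N0 => // N N0N u uK T T0.
by apply: small_energy => //; exact: NN.
Qed.

(** The error delta N is compared with delta N' for an N', depending on M, such
    that the energy of the latter up to M is at most 1.  Their difference is one
    of Galerkin solutions, whose energies are at most E in every dimension, and
    two uses of the parallelogram bound [energyD] give
    2 * 1 + 2 * (2 * E + 2 * E). *)
Lemma propagator_energy N u T M : (\sum_(l < p) control_L1 u l < K%:E)%E ->
  0 <= T -> en k M (delta N u T) <= 2 + 8 * E.
Proof.
move=> uK T0.
have [N' /(_ u uK T T0) deltaN'] :=
  filter_ex (@near_propagator_small_energy k M 1 ltr01).
have enE P : en k M (X P u T 0 (proj P psi)) <= E.
  have [xP xE] := galerkin_span_energy T0 uK (psiE P).
  exact: le_trans (energy_span lambda phi_on _ _ xP) xE.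
have -> : delta N u T =
    delta N' u T + (X N' u T 0 (proj N' psi) - X N u T 0 (proj N psi)).
  by rewrite addrA subrK.
have := energyD phi lambda k M (delta N' u T)
  (X N' u T 0 (proj N' psi) - X N u T 0 (proj N psi)).
have := energyD phi lambda k M
  (X N' u T 0 (proj N' psi)) (- X N u T 0 (proj N psi)).
rewrite energyN; have := enE N; have := enE N'; lra.
Qed.

(** Interpolation between the convergence in H, which settles the coordinates
    below P, and the bound on the energy of order k, which settles the rest. *)
Lemma near_propagator_energy s c : s < k -> 0 < c ->
  \forall N \near \oo, forall u, (\sum_(l < p) control_L1 u l < K%:E)%E ->
    forall T, 0 <= T -> forall M, en s M (delta N u T) <= c.
Proof.
move=> sk c0; pose F := 2 + 8 * E.
have F0 : 0 <= F by apply: addr_ge0 => //; apply: mulr_ge0.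
have F1 : 0 < F + 1 by exact: ltr_wpDl.
have c2 : 0 < c / 2 by rewrite divr_gt0.
have e0 : 0 < c / 2 / (F + 1) by rewrite divr_gt0.
have [P Pdom] := powR_dominated (ii_positive hii) (ii_nondecreasing hii)
  (ii_unbounded hii) sk e0.
have := @near_propagator_small_energy s P _ c2.
apply: filterS => N small u uK T T0 M.
apply: le_trans (energy_split phi M (delta N u T) Pdom (ltW e0)) _.
rewrite [leRHS]splitr lerD ?small// mulrAC ler_pdivrMr// ler_wpM2l ?(ltW c2)//.
by rewrite (le_trans (propagator_energy N M uK T0))// /F lerDl.
Qed.

End FixedDatum.

End Approximation.

(** * Uniform approximation *)

Theorem theorem4 (R : realType) (H : hilbertSpace R) (p : nat)
  (A : operator H) (B : 'I_p -> operator H)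
  (phi : nat -> H) (lambda : nat -> R)
  (e : ('I_p -> R) -> R -> H -> H)
  (X : nat -> pw_control R p -> R -> R -> H -> H)
  (k s d r : R)
  (hs : 0 <= s) (hsk : s < k)
  (hi : condition_i A B)
  (hii : condition_ii A phi lambda)
  (hwc : weakly_coupled A B phi lambda k)
  (hd : 0 < d) (hr : 0 <= r) (hrk : r < k)
  (hB : forall l psi, absA_dom phi lambda (r / 2) psi ->
     op_dom (B l) psi /\ rnorm (B l psi) <= d * absA_norm phi lambda (r / 2) psi)
  (he : forall v, unitary_group_of (closure (perturbed A B v)) (e v))
  (hX : forall N u, galerkin_propagator A B phi N u (X N u)) :
  forall (eps K : R) (n : nat) (psi : 'I_n -> H),
    0 < eps -> 0 <= K -> (0 < n)%N ->
    (forall j, absA_dom phi lambda (k / 2) (psi j)) ->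
    exists2 N : nat, (0 < N)%N &
      forall u : pw_control R p,
        (\sum_(l < p) control_L1 u l < K%:E)%E ->
        forall (t : R) (j : 'I_n), 0 <= t ->
          let delta :=
            propagator e u t (psi j) - X N u t 0 (galerkin_proj phi N (psi j)) in
          absA_dom phi lambda (s / 2) delta /\
          absA_norm phi lambda (s / 2) delta < eps.
Proof.
move=> eps K n psi eps0 K0 _ psi_dom.
have [_ [C hC]] := hwc.
have [phi_on _] := ii_basis hii.
have eps2 : 0 < eps ^+ 2 / 2 by rewrite divr_gt0// exprn_gt0.
have : \forall N \near \oo, forall j : 'I_n, forall u : pw_control R p,
    (\sum_(l < p) control_L1 u l < K%:E)%E -> forall t, 0 <= t ->
    forall M, energy phi lambda s M
      (propagator e u t (psi j) - X N u t 0 (galerkin_proj phi N (psi j))) <=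
      eps ^+ 2 / 2.
  apply: filter_forall => j; have [S psiS] := (absA_domP _ _ _ _).1 (psi_dom j).
  exact: (near_propagator_energy hii hC he hX hrk hd hB psiS K0 hsk eps2).
move=> /(filterI (nbhs_infty_gt 0)) /filter_ex[N [N0 small]].
exists N => // u uK t j t0 delta.
have deltaM M : energy phi lambda s M delta <= eps ^+ 2 / 2 by exact: small.
split; first by apply/absA_domP; exists (eps ^+ 2 / 2).
rewrite -(@ltr_pXn2r _ 2)// ?nnegrE ?rnorm_ge0 ?(ltW eps0)//.
apply: le_lt_trans (absA_norm_le phi_on (ii_positive hii) deltaM) _.
by rewrite ltr_pdivrMr// ltr_pMr ?exprn_gt0// ltr1n.
Qed.
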